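(* Let $\lambda>0$ and $0<\nu\le 1$. Then for all $x\in\mathbb{R}$, $t>0$, \[ u_{\nu}(x,t)=\frac{1}{\sqrt{\pi t}}\int_{0}^{\infty}e^{-z^{2}/(4t)}\,u_{2\nu}(x,z)\,dz , \] where $u_\nu$ is the solution of $\frac{\partial^{\nu}u}{\partial t^{\nu}}=\lambda^{2}\frac{\partial^{2}u}{\partial x^{2}}$ with $u(x,0)=\delta(x)$, and $u_{2\nu}$ is the solution of $\frac{\partial^{2\nu}u}{\partial z^{2\nu}}=\lambda^{2}\frac{\partial^{2}u}{\partial x^{2}}$ ($x\in\mathbb{R}$, $z>0$) with $u(x,0)=\delta(x)$ when $0<\nu\le\frac12$, and with $u(x,0)=\delta(x)$, $u_z(x,0)=0$ when $\frac12<\nu\le 1$.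
   Context: Fractional time derivatives are in the Dzherbashyan–Caputo sense: for $m-1<\nu<m$ ($m$ a positive integer), $\frac{\partial^{\nu}u}{\partial t^{\nu}}(x,t)=\frac{1}{\Gamma(m-\nu)}\int_0^t (t-s)^{m-\nu-1}\frac{\partial^m u}{\partial s^m}(x,s)\,ds$, and for $\nu=m$ it is the ordinary $m$-th derivative. For $0<\mu\le 2$ and $\lambda>0$, the solution $u_\mu$ of $\frac{\partial^{\mu}u}{\partial t^{\mu}}=\lambda^{2}\frac{\partial^{2}u}{\partial x^{2}}$, $x\in\mathbb{R}$, $t>0$, with $u(x,0)=\delta(x)$ (if $0<\mu\le1$) or $u(x,0)=\delta(x)$, $u_t(x,0)=0$ (if $1<\mu\le 2$), is \[u_\mu(x,t)=\frac{1}{2\lambda t^{\mu/2}}\sum_{k=0}^\infty\frac{\left(-|x|/(\lambda t^{\mu/2})\right)^k}{k!\,\Gamma(-\mu k/2+1-\mu/2)}.\]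
   Formalization: At ν=1 the series for u_2 vanishes identically and the true u_2 is the distribution (δ(x−λz)+δ(x+λz))/2, so there the integral is replaced by its evaluated value e^{−x²/(4λ²t)}/(2λ); for 0<ν<1 the identity is as stated, with u_ν, u_{2ν} given by their series. *)

(* Defs.v *)
From Stdlib Require Import Reals Factorial.
From Coquelicot Require Import Coquelicot.
Open Scope R_scope.

Definition Gamma (x : R) : R :=
  RInt_gen (fun s => Rpower s (x - 1) * exp (- s)) (at_right 0) (Rbar_locally p_infty).

Fixpoint poch (x : R) (n : nat) : R :=
  match n with
  | O => 1
  | S m => poch x m * (x + INR m)
  end.

(** Reciprocal Gamma function 1/Gamma(x) on all of R, extended by the functional
    equation: 1/Gamma(x) = x(x+1)...(x+n-1) / Gamma(x+n) with x+n > 0.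
    It vanishes at the poles x = 0, -1, -2, ... *)
Definition rgamma (x : R) : R :=
  let n := Z.to_nat (up (- x)) in poch x n / Gamma (x + INR n).

Definition u (mu lambda x t : R) : R :=
  / (2 * lambda * Rpower t (mu / 2)) *
  Series (fun k : nat =>
    (- Rabs x / (lambda * Rpower t (mu / 2))) ^ k / INR (Factorial.fact k)
    * rgamma (- mu * INR k / 2 + 1 - mu / 2)).

(* Main.v *)
Require Import Defs.
From Stdlib Require Import Reals.
From Coquelicot Require Import Coquelicot.
From Stdlib Require Import ZArith Lra Lia Psatz Factorial.
Open Scope R_scope.

(** Write X = |x| / lambda and let M_s be the M-Wright function, so that u_nu(x,t) is
    t^(-nu/2) M_(nu/2)(X t^(-nu/2)) / (2 lambda). Integrating the series of u_(2 nu) termwise against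
    the Gaussian gives divergent integrals at z = 0. Instead, put
    h(r) = Im (i^nu r^(nu-1) exp(-X (i r)^nu)), which is absolutely integrable for X > 0 and nu < 1.
    Then z^(-nu) M_nu(X z^(-nu)) = (2/PI) * integral of cos(r z) h(r) dr: with cos(r z) replaced by
    Re exp(-r z e^(-i phi)), phi < PI/2, the exponential series in h can be integrated termwise by
    rotated Gamma integrals and the reflection formula, and then phi tends to PI/2. By Fubini, the
    Gaussian average replaces cos(r z) by exp(-t r^2), and termwise integration of exp(-t r^2) h(r)
    is legitimate and gives u_nu. The case X = 0 follows by continuity.

    The reflection formula itself comes from the same rotation: it gives
    B(a/2) = 2 B(a) cos(PI a/2) for B(a) = Gamma(a) Gamma(1-a), so B(a) sin(PI a) is invariant under
    halving a and equals its limit PI at 0. *)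

(** * Absolutely convergent integrals over the half-line *)

Definition poscont (f : R -> R) : Prop := forall x, 0 < x -> continuous f x.

Definition pint (f : R -> R) (l : R) : Prop :=
  is_RInt_gen f (at_right 0) (Rbar_locally p_infty) l.

Lemma poscont_ex_RInt f a b : poscont f -> 0 < a -> 0 < b -> ex_RInt f a b.
Proof.
intros Hf Ha Hb. apply (@ex_RInt_continuous R_CompleteNormedModule).
intros z [Hz _]. apply Hf. apply Rlt_le_trans with (2 := Hz).
now apply Rmin_glb_lt.
Qed.

Lemma pintP f l : poscont f ->
  (pint f l <->
   forall eps, 0 < eps -> exists d M, (0 < d <= 1 /\ 1 <= M) /\
     forall a b, 0 < a < d -> M < b -> Rabs (RInt f a b - l) < eps).
Proof.
intros Hf; split.
- intros H eps He.
  destruct (H (ball l (mkposreal eps He)) (locally_ball l (mkposreal eps He)))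
    as [Q S [d Hd] [M HM] HQS].
  exists (Rmin d 1), (Rmax M 1). split.
    { split; [split|]. apply Rmin_glb_lt. apply d. lra. apply Rmin_r. apply Rmax_r. }
  intros a b [Ha1 Ha2] Hb.
  assert (Qa : Q a).
  { apply Hd; auto. change (Rabs (a - 0) < d). rewrite Rminus_0_r, Rabs_pos_eq by lra.
    apply Rlt_le_trans with (1 := Ha2). apply Rmin_l. }
  assert (Sb : S b).
  { apply HM. apply Rle_lt_trans with (2 := Hb). apply Rmax_l. }
  destruct (HQS a b Qa Sb) as [y [Hy1 Hy2]].
  simpl in Hy1. rewrite (is_RInt_unique _ _ _ _ Hy1). exact Hy2.
- intros H P [e HP].
  destruct (H e (cond_pos e)) as [d [M [[[Hd _] HM] Hab]]].
  exists (fun a => 0 < a < d) (fun b => M < b).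
  + exists (mkposreal d Hd). intros y Hy Hy0.
    change (Rabs (y - 0) < d) in Hy. rewrite Rminus_0_r, Rabs_pos_eq in Hy; lra.
  + now exists M.
  + intros a b Ha Hb. exists (RInt f a b). split.
    apply (@RInt_correct R_CompleteNormedModule). apply poscont_ex_RInt; lra || auto.
    apply HP. now apply Hab.
Qed.

Lemma pint_unique f l1 l2 : pint f l1 -> pint f l2 -> l1 = l2.
Proof.
intros H1 H2.
rewrite <- (is_RInt_gen_unique (V:=R_CompleteNormedModule) _ _ H1).
exact (is_RInt_gen_unique (V:=R_CompleteNormedModule) _ _ H2).
Qed.

Lemma pint_ext f g l : (forall x, 0 < x -> f x = g x) -> pint f l -> pint g l.
Proof.
intros H. apply is_RInt_gen_ext.
exists (fun a => 0 < a) (fun b => 0 < b).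
- exists (mkposreal 1 Rlt_0_1). intros y _ Hy. exact Hy.
- exists 0. auto.
- intros a b Ha Hb x Hx. simpl in Hx. apply H.
  assert (0 < Rmin a b) by now apply Rmin_glb_lt. lra.
Qed.

Lemma pint_eq f l m : l = m -> pint f l -> pint f m.
Proof. now intros <-. Qed.

Lemma pint_scal f k l : pint f l -> pint (fun x => k * f x) (k * l).
Proof. exact (is_RInt_gen_scal f k l). Qed.

Lemma pint_plus f g l m : pint f l -> pint g m -> pint (fun x => f x + g x) (l + m).
Proof. exact (is_RInt_gen_plus f g l m). Qed.

Lemma pint_minus f g l m : pint f l -> pint g m -> pint (fun x => f x - g x) (l - m).
Proof. exact (is_RInt_gen_minus f g l m). Qed.

Lemma poscont_RInt_abs_le f g a b :
  poscont f -> poscont g -> (forall x, 0 < x -> Rabs (f x) <= g x) ->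
  0 < a <= b -> Rabs (RInt f a b) <= RInt g a b.
Proof.
intros Hf Hg Hfg [Ha Hab].
apply Rle_trans with (RInt (fun x => Rabs (f x)) a b).
- apply abs_RInt_le; auto. apply poscont_ex_RInt; lra || auto.
- apply RInt_le; auto.
  + apply poscont_ex_RInt; try lra. intros x Hx.
    apply (continuous_comp f Rabs); auto. apply (continuous_Rabs (f x)).
  + apply poscont_ex_RInt; lra || auto.
  + intros x Hx. apply Hfg. lra.
Qed.

Lemma poscont_RInt_diff_le f g a b c d :
  poscont f -> poscont g -> (forall x, 0 < x -> Rabs (f x) <= g x) ->
  0 < a -> a <= b -> b <= c -> c <= d ->
  Rabs (RInt f a d - RInt f b c) <= RInt g a d - RInt g b c.
Proof.
intros Hf Hg Hfg Ha Hab Hbc Hcd.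
assert (C : forall h, poscont h -> RInt h a d = RInt h a b + RInt h b c + RInt h c d).
{ intros h Hh.
  rewrite <- (RInt_Chasles h a b d), <- (RInt_Chasles h b c d);
    try (apply poscont_ex_RInt; lra || auto).
  unfold plus; simpl. ring. }
rewrite (C f Hf), (C g Hg).
replace (RInt f a b + RInt f b c + RInt f c d - RInt f b c)
  with (RInt f a b + RInt f c d) by ring.
apply Rle_trans with (1 := Rabs_triang _ _).
assert (B1 := poscont_RInt_abs_le f g a b Hf Hg Hfg ltac:(lra)).
assert (B2 := poscont_RInt_abs_le f g c d Hf Hg Hfg ltac:(lra)).
lra.
Qed.

Lemma pint_dominated f g L :
  poscont f -> poscont g -> (forall x, 0 < x -> Rabs (f x) <= g x) -> pint g L ->
  exists l, pint f l.
Proof.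
intros Hf Hg Hfg HL.
set (F := filter_prod (at_right 0) (Rbar_locally p_infty)).
assert (PF : ProperFilter F) by (apply filter_prod_proper).
destruct (proj1 (filterlim_locally_cauchy (F := F) (U := R_CompleteSpace)
  (fun ab : R * R => RInt f (fst ab) (snd ab)))) as [l Hl].
- intros e.
  destruct (proj1 (pintP g L Hg) HL (e/4) ltac:(destruct e; simpl; lra))
    as [d [M [[[Hd Hd1] HM] Hab]]].
  exists (fun ab => (0 < fst ab < d) /\ M < snd ab). split.
  + exists (fun a => 0 < a < d) (fun b => M < b); auto.
    * exists (mkposreal d Hd). intros y Hy Hy0.
      change (Rabs (y - 0) < d) in Hy. rewrite Rminus_0_r, Rabs_pos_eq in Hy; lra.
    * now exists M.
  + assert (K : forall a b a' b', 0 < a < d -> M < b -> 0 < a' < d -> M < b' ->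
      a' <= a -> b <= b' -> Rabs (RInt f a' b' - RInt f a b) < e / 2).
    { intros a b a' b' Ha Hb Ha' Hb' H1 H2.
      apply Rle_lt_trans with
        (1 := poscont_RInt_diff_le f g a' a b b' Hf Hg Hfg ltac:(lra) H1 ltac:(lra) H2).
      assert (B1 := Hab a b Ha Hb). assert (B2 := Hab a' b' Ha' Hb').
      apply Rabs_def2 in B1. apply Rabs_def2 in B2. lra. }
    intros [a b] [a' b'] [Ha Hb] [Ha' Hb']. simpl in *.
    set (m := Rmin a a'). set (n := Rmax b b').
    assert (Hm : 0 < m < d).
    { split. apply Rmin_glb_lt; lra. apply Rle_lt_trans with (1 := Rmin_l _ _); lra. }
    assert (Hn : M < n) by (apply Rlt_le_trans with (2 := Rmax_l _ _); lra).
    assert (B1 := K a b m n Ha Hb Hm Hn (Rmin_l _ _) (Rmax_l _ _)).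
    assert (B2 := K a' b' m n Ha' Hb' Hm Hn (Rmin_r _ _) (Rmax_r _ _)).
    change (Rabs (RInt f a' b' - RInt f a b) < e).
    apply Rabs_def2 in B1. apply Rabs_def2 in B2. apply Rabs_def1; lra.
- exists l. apply pintP; auto. intros eps He.
  destruct (Hl (ball l (mkposreal eps He)) (locally_ball l (mkposreal eps He)))
    as [Q S [d Hd] [M HM] HQS].
  exists (Rmin d 1), (Rmax M 1). split.
    { split; [split|]. apply Rmin_glb_lt. apply d. lra. apply Rmin_r. apply Rmax_r. }
  intros a b [Ha1 Ha2] Hb. apply (HQS a b).
  + apply Hd; auto. change (Rabs (a - 0) < d). rewrite Rminus_0_r, Rabs_pos_eq by lra.
    apply Rlt_le_trans with (1 := Ha2). apply Rmin_l.
  + apply HM. apply Rle_lt_trans with (2 := Hb). apply Rmax_l.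
Qed.

Lemma pint_tail_le f g l L a b :
  poscont f -> poscont g -> (forall x, 0 < x -> Rabs (f x) <= g x) ->
  pint f l -> pint g L -> 0 < a <= b ->
  Rabs (l - RInt f a b) <= L - RInt g a b.
Proof.
intros Hf Hg Hfg Hl HL [Ha Hab].
apply le_epsilon. intros eps He.
destruct (proj1 (pintP g L Hg) HL (eps/2) ltac:(lra)) as [d [M [[[Hd Hd1] HM] H1]]].
destruct (proj1 (pintP f l Hf) Hl (eps/2) ltac:(lra)) as [d' [M' [[[Hd' Hd1'] HM'] H2]]].
set (m := Rmin a (Rmin d d') / 2). set (n := Rmax b (Rmax M M') + 1).
assert (0 < Rmin a (Rmin d d')) by (repeat apply Rmin_glb_lt; lra).
assert (B1 := Rmin_l a (Rmin d d')). assert (B2 := Rmin_r a (Rmin d d')).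
assert (B3 := Rmin_l d d'). assert (B4 := Rmin_r d d').
assert (B5 := Rmax_l b (Rmax M M')). assert (B6 := Rmax_r b (Rmax M M')).
assert (B7 := Rmax_l M M'). assert (B8 := Rmax_r M M').
specialize (H1 m n). specialize (H2 m n).
assert (H3 := poscont_RInt_diff_le f g m a b n Hf Hg Hfg).
unfold m, n in *. specialize (H1 ltac:(lra) ltac:(lra)).
specialize (H2 ltac:(lra) ltac:(lra)).
specialize (H3 ltac:(lra) ltac:(lra) ltac:(lra) ltac:(lra)).
apply Rabs_def2 in H1. apply Rabs_def2 in H2. apply Rabs_le_between in H3.
apply Rabs_le_between. lra.
Qed.

Lemma poscont_const c : poscont (fun _ => c).
Proof. intros x _. apply continuous_const. Qed.

Lemma pint_le f g l m : poscont f -> poscont g ->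
  (forall x, 0 < x -> f x <= g x) -> pint f l -> pint g m -> l <= m.
Proof.
intros Hf Hg Hfg Hl Hm. apply le_epsilon. intros eps He.
destruct (proj1 (pintP g m Hg) Hm (eps/2) ltac:(lra)) as [d [M [[[Hd Hd1] HM] H1]]].
destruct (proj1 (pintP f l Hf) Hl (eps/2) ltac:(lra)) as [d' [M' [[[Hd' Hd1'] HM'] H2]]].
assert (0 < Rmin d d') by (apply Rmin_glb_lt; lra).
assert (B3 := Rmin_l d d'). assert (B4 := Rmin_r d d').
assert (B7 := Rmax_l M M'). assert (B8 := Rmax_r M M').
specialize (H1 (Rmin d d' / 2) (Rmax M M' + 1) ltac:(lra) ltac:(lra)).
specialize (H2 (Rmin d d' / 2) (Rmax M M' + 1) ltac:(lra) ltac:(lra)).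
assert (RInt f (Rmin d d' / 2) (Rmax M M' + 1) <= RInt g (Rmin d d' / 2) (Rmax M M' + 1)).
{ apply RInt_le; try (apply poscont_ex_RInt; lra || auto). lra.
  intros x Hx. apply Hfg. lra. }
apply Rabs_def2 in H1. apply Rabs_def2 in H2. lra.
Qed.

Lemma pint_abs_le f g l m : poscont f -> poscont g ->
  (forall x, 0 < x -> Rabs (f x) <= g x) -> pint f l -> pint g m -> Rabs l <= m.
Proof.
intros Hf Hg Hfg Hl Hm.
assert (H : forall x, 0 < x -> - g x <= f x <= g x).
{ intros x Hx. apply Rabs_le_between. auto. }
apply Rabs_le_between. split.
- replace (- m) with (-1 * m) by ring.
  apply (pint_le (fun x => -1 * g x) f); auto.
  + intros x Hx. apply (continuous_mult (fun _ => -1) g). apply continuous_const. auto.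
  + intros x Hx. specialize (H x Hx). lra.
  + now apply pint_scal.
- apply (pint_le f g); auto. intros x Hx. now apply H.
Qed.

Lemma pint_pos f l : poscont f -> (forall x, 0 < x -> 0 < f x) -> pint f l -> 0 < l.
Proof.
intros Hf Hp Hl.
assert (0 < RInt f 1 2).
{ apply RInt_gt_0. lra. intros x Hx. apply Hp; lra. intros x Hx. apply Hf; lra. }
assert (H1 := pint_tail_le f f l l 1 2 Hf Hf
  ltac:(intros; rewrite Rabs_pos_eq; [lra | left; auto]) Hl Hl ltac:(lra)).
assert (H2 := Rle_abs (-(l - RInt f 1 2))). rewrite Rabs_Ropp in H2.
assert (H3 := Rabs_pos (l - RInt f 1 2)). lra.
Qed.

Lemma pint_derive (F f : R -> R) l0 l1 :
  (forall x, 0 < x -> is_derive F x (f x)) -> poscont f ->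
  filterlim F (at_right 0) (locally l0) ->
  filterlim F (Rbar_locally p_infty) (locally l1) -> pint f (l1 - l0).
Proof.
intros HF Hf H0 H1. apply pintP; auto. intros eps He.
destruct (H0 (ball l0 (eps/2)) (locally_ball l0 (mkposreal (eps/2) ltac:(lra)))) as [d Hd].
destruct (H1 (ball l1 (eps/2)) (locally_ball l1 (mkposreal (eps/2) ltac:(lra)))) as [M HM].
exists (Rmin d 1), (Rmax M 1). split.
{ split; [split|]. apply Rmin_glb_lt. apply d. lra. apply Rmin_r. apply Rmax_r. }
intros a b [Ha1 Ha2] Hb.
assert (A : Rabs (F a - l0) < eps / 2).
{ apply Hd; auto. change (Rabs (a - 0) < d). rewrite Rminus_0_r, Rabs_pos_eq by lra.
  apply Rlt_le_trans with (1 := Ha2). apply Rmin_l. }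
assert (B : Rabs (F b - l1) < eps / 2).
{ apply HM. apply Rle_lt_trans with (2 := Hb). apply Rmax_l. }
assert (B1 := Rmin_r d 1). assert (B2 := Rmax_r M 1).
assert (E : RInt f a b = F b - F a).
{ apply is_RInt_unique. apply (is_RInt_derive F f).
  - intros x Hx. apply HF. rewrite Rmin_left in Hx; lra.
  - intros x Hx. apply Hf. rewrite Rmin_left in Hx; lra. }
rewrite E. apply Rabs_def2 in A. apply Rabs_def2 in B. apply Rabs_def1; lra.
Qed.

(* Dominated convergence, in the weak form where pointwise convergence is replaced by
   uniform convergence on compact subintervals. *)
Lemma pint_lim (f : nat -> R -> R) (f0 g : R -> R) (l : nat -> R) (L : R) :
  (forall n, poscont (f n)) -> poscont f0 -> poscont g -> pint g L ->
  (forall n x, 0 < x -> Rabs (f n x) <= g x) ->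
  (forall a b eps, 0 < a < b -> 0 < eps ->
     exists N, forall n, (N <= n)%nat -> forall x, a <= x <= b -> Rabs (f n x - f0 x) < eps) ->
  (forall n, pint (f n) (l n)) ->
  exists l0, pint f0 l0 /\ is_lim_seq l l0.
Proof.
intros Hf Hf0 Hg HL Hdom Hunif Hl.
assert (Hdom0 : forall x, 0 < x -> Rabs (f0 x) <= g x).
{ intros x Hx. apply le_epsilon. intros eps He.
  destruct (Hunif x (x+1) eps ltac:(lra) He) as [N HN].
  specialize (HN N (Nat.le_refl N) x ltac:(lra)).
  specialize (Hdom N x Hx). apply Rabs_le_between in Hdom. apply Rabs_def2 in HN.
  apply Rabs_le_between; lra. }
destruct (pint_dominated f0 g L Hf0 Hg Hdom0 HL) as [l0 Hl0].
exists l0. split; auto.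
apply is_lim_seq_spec. intros eps. assert (He := cond_pos eps).
destruct (proj1 (pintP g L Hg) HL (eps/4) ltac:(lra)) as [d [M [[[Hd Hd1] HM] H1]]].
set (a := d / 2) in *. set (b := M + 1) in *.
assert (Hab : 0 < a < b) by (unfold a, b; lra).
specialize (H1 a b ltac:(unfold a; lra) ltac:(unfold b; lra)). apply Rabs_def2 in H1.
destruct (Hunif a b (eps / (4 * (b - a))) Hab) as [N HN].
{ apply Rdiv_lt_0_compat; lra. }
exists N. intros n Hn. specialize (HN n Hn).
assert (T1 := pint_tail_le (f n) g (l n) L a b (Hf n) Hg (Hdom n) (Hl n) HL ltac:(lra)).
assert (T2 := pint_tail_le f0 g l0 L a b Hf0 Hg Hdom0 Hl0 HL ltac:(lra)).
assert (T3 : Rabs (RInt (f n) a b - RInt f0 a b) <= eps / 4).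
{ assert (X1 : ex_RInt (f n) a b) by (apply poscont_ex_RInt; lra || auto).
  assert (X2 : ex_RInt f0 a b) by (apply poscont_ex_RInt; lra || auto).
  assert (E := RInt_minus (V := R_CompleteNormedModule) (f n) f0 a b X1 X2).
  unfold minus, plus, opp in E; simpl in E.
  replace (RInt (f n) a b - RInt f0 a b) with (RInt (fun x => f n x + - f0 x) a b) by exact E.
  replace (eps / 4) with ((b - a) * (eps / (4 * (b - a)))) by (field; lra).
  apply abs_RInt_le_const. lra.
  - apply (ex_RInt_minus (V := R_NormedModule) (f n) f0); auto.
  - intros x Hx. left. now apply HN. }
apply Rabs_le_between in T1. apply Rabs_le_between in T2. apply Rabs_le_between in T3.
apply Rabs_def1; lra.
Qed.

Definition poscont2 (F : R -> R -> R) : Prop :=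
  forall x y, 0 < x -> 0 < y -> continuity_2d_pt F x y.

Lemma poscont2_flip F : poscont2 F -> poscont2 (fun x y => F y x).
Proof.
intros H x y Hx Hy e. destruct (H y x Hy Hx e) as [d Hd].
exists d. intros u v Hu Hv. now apply Hd.
Qed.

Lemma poscont2_1 F y : 0 < y -> poscont2 F -> poscont (fun x => F x y).
Proof.
intros Hy H x Hx. apply continuity_pt_filterlim. intros e He.
destruct (H x y Hx Hy (mkposreal e He)) as [d Hd].
exists d. split. apply d. intros u [_ Hu].
apply (Hd u y Hu). rewrite Rminus_diag, Rabs_R0. apply d.
Qed.

Lemma poscont2_2 F x : 0 < x -> poscont2 F -> poscont (F x).
Proof.
intros Hx H. apply (poscont2_1 (fun u v => F v u) x Hx). now apply poscont2_flip.
Qed.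

Lemma poscont_RInt_param F a b : poscont2 F -> 0 < a <= b ->
  poscont (fun y => RInt (fun x => F x y) a b).
Proof.
intros HF Hab y Hy. apply continuity_pt_filterlim. intros e He.
assert (He' : 0 < e / (2 * (b - a + 1))) by (apply Rdiv_lt_0_compat; lra).
destruct (uniform_continuity_2d_1d F a b y
  ltac:(intros x Hx; apply HF; lra) (mkposreal _ He')) as [d Hd].
assert (0 < Rmin d y) by (apply Rmin_glb_lt; [apply d | lra]).
exists (Rmin d y). split; auto. intros v [_ Hv].
change (Rabs (v - y) < Rmin d y) in Hv.
assert (B1 := Rmin_l d y). assert (B2 := Rmin_r d y).
change (Rabs (RInt (fun x => F x v) a b - RInt (fun x => F x y) a b) < e).
assert (Hv0 : 0 < v) by (apply Rabs_def2 in Hv; lra).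
assert (X1 : ex_RInt (fun x => F x v) a b)
  by (apply poscont_ex_RInt; [now apply poscont2_1 | lra | lra]).
assert (X2 : ex_RInt (fun x => F x y) a b)
  by (apply poscont_ex_RInt; [now apply poscont2_1 | lra | lra]).
assert (E := RInt_minus (V := R_CompleteNormedModule) _ _ a b X1 X2).
unfold minus, plus, opp in E; simpl in E. unfold Rminus at 1. rewrite <- E.
apply Rle_lt_trans with ((b - a) * (e / (2 * (b - a + 1)))).
- apply abs_RInt_le_const. lra.
  + apply (ex_RInt_minus (V := R_NormedModule)  _ _ _ _ X1 X2).
  + intros x Hx. left. apply Rabs_def2 in Hv.
    assert (Hdp := cond_pos d).
    apply (Hd x y x v); try lra.
    rewrite Rminus_diag, Rabs_R0. apply d.
- apply Rle_lt_trans with (e / 2); [|lra].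
  apply Rmult_le_reg_r with (2 * (b - a + 1)); [lra|]. field_simplify; nra.
Qed.

Lemma RInt_swap F a b c d : poscont2 F -> 0 < a <= b -> 0 < c <= d ->
  RInt (fun y => RInt (fun x => F x y) a b) c d = RInt (fun x => RInt (F x) c d) a b.
Proof.
intros HF Hab Hcd. symmetry. apply is_RInt_unique.
set (Phi u := RInt (fun y => RInt (fun x => F x y) a u) c d).
replace (RInt (fun y => RInt (fun x => F x y) a b) c d) with (minus (Phi b) (Phi a)).
2:{ unfold Phi. rewrite (RInt_ext (fun y => RInt (fun x => F x y) a a) (fun _ => 0)).
    2:{ intros y _. apply (RInt_point (V := R_CompleteNormedModule)). }
    rewrite RInt_const. unfold minus, plus, opp, scal; simpl. unfold mult; simpl. ring. }
assert (D : forall u v, 0 < u -> 0 < v ->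
  is_derive (fun z => RInt (fun x => F x v) a z) u (F u v)).
{ intros u v Hu Hv. apply (is_derive_RInt (fun x => F x v) _ a u).
  - exists (mkposreal u Hu). intros z Hz. change (Rabs (z - u) < u) in Hz.
    apply (@RInt_correct R_CompleteNormedModule). apply Rabs_def2 in Hz.
    apply poscont_ex_RInt; [now apply poscont2_1 | lra | lra].
  - now apply (poscont2_1 F v). }
assert (L : forall u, 0 < u -> locally u (fun z => 0 < z)).
{ intros u Hu. exists (mkposreal u Hu). intros z Hz. change (Rabs (z - u) < u) in Hz.
  apply Rabs_def2 in Hz. lra. }
apply (is_RInt_derive Phi (fun x => RInt (F x) c d)).
- intros u Hu. rewrite Rmin_left, Rmax_right in Hu by lra.
  replace (RInt (F u) c d) with
    (RInt (fun y => Derive (fun z => RInt (fun x => F x y) a z) u) c d).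
  2:{ apply RInt_ext. intros y Hy. rewrite Rmin_left in Hy by lra.
      apply is_derive_unique. apply D; lra. }
  apply is_derive_RInt_param.
  + destruct (L u ltac:(lra)) as [e He]. exists e. intros z Hz v Hv.
    rewrite Rmin_left in Hv by lra.
    exists (F z v). apply D. now apply He. lra.
  + intros v Hv. rewrite Rmin_left in Hv by lra.
    apply continuity_2d_pt_ext_loc with F.
    2:{ apply HF; lra. }
    assert (0 < Rmin u v) by (apply Rmin_glb_lt; lra).
    assert (B1 := Rmin_l u v). assert (B2 := Rmin_r u v).
    exists (mkposreal _ H). simpl. intros u' v' Hu' Hv'.
    symmetry. apply is_derive_unique.
    apply Rabs_def2 in Hu'. apply Rabs_def2 in Hv'. apply D; lra.
  + destruct (L u ltac:(lra)) as [e He]. exists e. intros z Hz.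
    specialize (He z Hz). apply poscont_ex_RInt; try lra.
    destruct (Rle_dec a z) as [Haz|Haz].
    * now apply poscont_RInt_param.
    * assert (P : poscont (fun y => - RInt (fun x => F x y) z a)).
      { intros y Hy. apply (continuous_opp (V := R_NormedModule)
          (fun y => RInt (fun x => F x y) z a)).
        apply poscont_RInt_param; auto. lra. }
      intros y Hy. apply continuous_ext_loc with (2 := P y Hy).
      destruct (L y Hy) as [e' He']. exists e'. intros v Hv.
      apply (opp_RInt_swap (V := R_CompleteNormedModule) (fun x => F x v)).
      apply poscont_ex_RInt; try lra. apply poscont2_1; auto.
- intros u Hu. rewrite Rmin_left, Rmax_right in Hu by lra.
  apply (poscont_RInt_param (fun x y => F y x)); try lra. now apply poscont2_flip.
Qed.

Lemma pint_RInt_le f l a b : poscont f -> (forall x, 0 < x -> 0 <= f x) ->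
  pint f l -> 0 < a <= b -> 0 <= RInt f a b <= l.
Proof.
intros Hf H0 Hl Hab. split.
- apply RInt_ge_0. lra. apply poscont_ex_RInt; lra || auto. intros x Hx. apply H0. lra.
- assert (H1 := pint_tail_le f f l l a b Hf Hf
    ltac:(intros; rewrite Rabs_pos_eq; [lra | auto]) Hl Hl Hab).
  assert (H3 := Rabs_pos (l - RInt f a b)). lra.
Qed.

Lemma poscont_scal c f : poscont f -> poscont (fun x => c * f x).
Proof.
intros Hf x Hx. apply (continuous_mult (fun _ => c) f). apply continuous_const. auto.
Qed.

Lemma poscont_mult f g : poscont f -> poscont g -> poscont (fun x => f x * g x).
Proof. intros Hf Hg x Hx. apply (continuous_mult f g); auto. Qed.

Lemma poscont_plus f g : poscont f -> poscont g -> poscont (fun x => f x + g x).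
Proof. intros Hf Hg x Hx. apply (continuous_plus f g); auto. Qed.

Lemma pint_iterated_RInt F g k G K A l m n :
  poscont2 F -> poscont g -> poscont k -> poscont A ->
  (forall x, 0 < x -> 0 <= g x) -> (forall y, 0 < y -> 0 <= k y) ->
  (forall x y, 0 < x -> 0 < y -> Rabs (F x y) <= g x * k y) ->
  pint g G -> pint k K -> (forall y, 0 < y -> pint (fun x => F x y) (A y)) -> pint A l ->
  0 < m <= n ->
  Rabs (l - RInt (fun y => RInt (fun x => F x y) m n) m n)
    <= G * (K - RInt k m n) + K * (G - RInt g m n).
Proof.
intros HF Hg Hk HA Hg0 Hk0 Hdom HG HK HFA Hl Hmn.
destruct (pint_RInt_le g G m n Hg Hg0 HG Hmn) as [G0 G1].
destruct (pint_RInt_le k K m n Hk Hk0 HK Hmn) as [K0 K1].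
assert (HAG : forall y, 0 < y -> Rabs (A y) <= G * k y).
{ intros y Hy. rewrite (Rmult_comm G).
  apply (pint_abs_le (fun x => F x y) (fun x => k y * g x)); auto.
  - now apply poscont2_1.
  - now apply poscont_scal.
  - intros x Hx. rewrite Rmult_comm. auto.
  - now apply pint_scal. }
assert (P1 : poscont (fun y => G * k y)) by now apply poscont_scal.
assert (P2 : poscont (fun y => RInt (fun x => F x y) m n)) by now apply poscont_RInt_param.
assert (T1 := pint_tail_le A (fun y => G * k y) l (G * K) m n HA P1 HAG Hl
  (pint_scal k G K HK) Hmn).
assert (S : forall c, RInt (fun y => c * k y) m n = c * RInt k m n).
{ intros c. apply (RInt_scal (V := R_CompleteNormedModule) k). apply poscont_ex_RInt; lra || auto. }
rewrite S in T1.
assert (X1 : ex_RInt A m n) by (apply poscont_ex_RInt; lra || auto).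
assert (X2 : ex_RInt (fun y => RInt (fun x => F x y) m n) m n)
  by (apply poscont_ex_RInt; lra || auto).
assert (E := RInt_minus (V := R_CompleteNormedModule) A _ m n X1 X2).
unfold minus, plus, opp in E; simpl in E.
assert (T2 : Rabs (RInt A m n - RInt (fun y => RInt (fun x => F x y) m n) m n)
  <= (G - RInt g m n) * RInt k m n).
{ unfold Rminus at 1. rewrite <- E, <- S. apply poscont_RInt_abs_le; try lra.
  - apply (poscont_plus A (fun y => - _)); auto.
    intros y Hy. apply (continuous_opp (V := R_NormedModule)
      (fun y => RInt (fun x => F x y) m n)). auto.
  - now apply poscont_scal.
  - intros y Hy.
    assert (Hy' : forall x, 0 < x -> Rabs (F x y) <= k y * g x)
    by (intros; rewrite Rmult_comm; auto).
  assert (T := pint_tail_le (fun x => F x y) (fun x => k y * g x) (A y) (k y * G) m n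
      (poscont2_1 F y Hy HF) (poscont_scal (k y) g Hg)
      Hy' (HFA y Hy) (pint_scal g (k y) G HG) Hmn).
    replace (RInt (fun x => k y * g x) m n) with (k y * RInt g m n) in T.
    2:{ symmetry. apply (RInt_scal (V := R_CompleteNormedModule) g).
        apply poscont_ex_RInt; lra || auto. }
    unfold Rminus in T. lra. }
apply Rabs_le_between in T1. apply Rabs_le_between in T2. apply Rabs_le_between.
assert ((G - RInt g m n) * RInt k m n <= K * (G - RInt g m n)) by nra.
lra.
Qed.

Lemma pint_fubini F g k G K A B :
  poscont2 F -> poscont g -> poscont k -> poscont A -> poscont B ->
  (forall x, 0 < x -> 0 <= g x) -> (forall y, 0 < y -> 0 <= k y) ->
  (forall x y, 0 < x -> 0 < y -> Rabs (F x y) <= g x * k y) ->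
  pint g G -> pint k K ->
  (forall y, 0 < y -> pint (fun x => F x y) (A y)) ->
  (forall x, 0 < x -> pint (F x) (B x)) ->
  exists l, pint A l /\ pint B l.
Proof.
intros HF Hg Hk HA HB Hg0 Hk0 Hdom HG HK HFA HFB.
assert (HAG : forall y, 0 < y -> Rabs (A y) <= G * k y).
{ intros y Hy. rewrite (Rmult_comm G).
  apply (pint_abs_le (fun x => F x y) (fun x => k y * g x)); auto.
  - now apply poscont2_1.
  - now apply poscont_scal.
  - intros x Hx. rewrite Rmult_comm. auto.
  - now apply pint_scal. }
assert (HBK : forall x, 0 < x -> Rabs (B x) <= K * g x).
{ intros x Hx. rewrite (Rmult_comm K).
  apply (pint_abs_le (F x) (fun y => g x * k y)); auto.
  - now apply poscont2_2.
  - now apply poscont_scal.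
  - now apply pint_scal. }
destruct (pint_dominated A (fun y => G * k y) (G * K)) as [l Hl]; auto.
{ now apply poscont_scal. } { now apply pint_scal. }
destruct (pint_dominated B (fun y => K * g y) (K * G)) as [l' Hl']; auto.
{ now apply poscont_scal. } { now apply pint_scal. }
exists l. split; auto.
replace l with l'; auto.
assert (HG0 : 0 <= G) by (apply (pint_RInt_le g G 1 1) in HG; auto; lra).
assert (HK0 : 0 <= K) by (apply (pint_RInt_le k K 1 1) in HK; auto; lra).
apply cond_eq. intros eps He.
set (e := eps / (2 * (G + K + 1))).
assert (He' : 0 < e) by (apply Rdiv_lt_0_compat; lra).
assert (Ee : e * (2 * (G + K + 1)) = eps) by (unfold e; field; lra).
destruct (proj1 (pintP g G Hg) HG e He') as [d [M [[[Hd Hd1] HM] H1]]].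
destruct (proj1 (pintP k K Hk) HK e He') as [d' [M' [[[Hd' Hd1'] HM'] H2]]].
assert (0 < Rmin d d') by (apply Rmin_glb_lt; lra).
assert (B3 := Rmin_l d d'). assert (B4 := Rmin_r d d').
assert (B7 := Rmax_l M M'). assert (B8 := Rmax_r M M').
set (m := Rmin d d' / 2) in *. set (n := Rmax M M' + 1) in *.
assert (Hmn : 0 < m <= n) by (unfold m, n; lra).
specialize (H1 m n ltac:(unfold m; lra) ltac:(unfold n; lra)).
specialize (H2 m n ltac:(unfold m; lra) ltac:(unfold n; lra)).
assert (T1 := pint_iterated_RInt F g k G K A l m n HF Hg Hk HA Hg0 Hk0 Hdom HG HK HFA Hl Hmn).
assert (Hdom' : forall y x, 0 < y -> 0 < x -> Rabs (F x y) <= k y * g x)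
  by (intros; rewrite Rmult_comm; auto).
assert (T2 := pint_iterated_RInt (fun x y => F y x) k g K G B l' m n (poscont2_flip F HF)
  Hk Hg HB Hk0 Hg0 Hdom' HK HG HFB Hl' Hmn).
rewrite (RInt_swap F m n m n HF Hmn Hmn) in T1.
assert (Q : forall x y z u v, Rabs (x - z) <= u -> Rabs (y - z) <= v -> Rabs (y - x) <= u + v).
{ intros x y z u v U V. apply Rabs_le_between in U. apply Rabs_le_between in V.
  apply Rabs_le_between. lra. }
apply Rle_lt_trans with (1 := Q _ _ _ _ _ T1 T2).
apply Rabs_def2 in H1. apply Rabs_def2 in H2.
assert (G * (K - RInt k m n) <= G * e) by (apply Rmult_le_compat_l; lra).
assert (K * (G - RInt g m n) <= K * e) by (apply Rmult_le_compat_l; lra).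
lra.
Qed.

Lemma is_derive_Rpower p x : 0 < x ->
  is_derive (fun x => Rpower x p) x (p * Rpower x (p - 1)).
Proof. intros Hx. apply is_derive_Reals. now apply derivable_pt_lim_power. Qed.

Lemma poscont_Rpower p : poscont (fun x => Rpower x p).
Proof.
intros x Hx. apply (ex_derive_continuous (V := R_NormedModule)).
exists (p * Rpower x (p - 1)). now apply is_derive_Rpower.
Qed.

Lemma Rpower_pos x p : 0 < Rpower x p.
Proof. apply exp_pos. Qed.

Lemma poscont_comp f g : poscont f -> poscont g -> (forall x, 0 < x -> 0 < g x) ->
  poscont (fun x => f (g x)).
Proof. intros Hf Hg H x Hx. apply (continuous_comp g f); auto. Qed.

Lemma Rpower_lt_inv a b p : 0 < p -> 0 < a -> 0 < b ->
  a < Rpower b (/ p) -> Rpower a p < b.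
Proof.
intros Hp Ha Hb H.
apply Rlt_le_trans with (Rpower (Rpower b (/ p)) p).
now apply Rlt_Rpower_l. rewrite Rpower_mult, Rinv_l, Rpower_1; lra.
Qed.

Lemma Rpower_gt_inv a b p : 0 < p -> 0 < a -> 0 < b ->
  Rpower b (/ p) < a -> b < Rpower a p.
Proof.
intros Hp Ha Hb H.
apply Rle_lt_trans with (Rpower (Rpower b (/ p)) p).
rewrite Rpower_mult, Rinv_l, Rpower_1; lra.
apply Rlt_Rpower_l; auto. split; auto. apply Rpower_pos.
Qed.

Lemma pint_subst_Rpower f l c p : 0 < c -> 0 < p -> poscont f -> pint f l ->
  pint (fun x => c * (p * Rpower x (p - 1)) * f (c * Rpower x p)) l.
Proof.
intros Hc Hp Hf Hl.
assert (Hg : forall x, 0 < x -> 0 < c * Rpower x p)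
  by (intros; apply Rmult_lt_0_compat; auto; apply Rpower_pos).
assert (P1 : poscont (fun x => c * (p * Rpower x (p - 1))))
  by (repeat apply poscont_scal; apply poscont_Rpower).
apply pintP.
{ apply (poscont_mult (fun x => c * (p * Rpower x (p - 1)))); auto.
  apply (poscont_comp f); auto. apply poscont_scal, poscont_Rpower. }
intros eps He.
destruct (proj1 (pintP f l Hf) Hl eps He) as [d [M [[[Hd Hd1] HM] H1]]].
exists (Rmin (Rpower (d / c) (/ p)) 1), (Rmax (Rpower (M / c) (/ p)) 1).
split. { split; [split|]. apply Rmin_glb_lt. apply Rpower_pos. lra. apply Rmin_r. apply Rmax_r. }
intros a b [Ha1 Ha2] Hb.
assert (B1 := Rmin_l (Rpower (d / c) (/ p)) 1). assert (B2 := Rmin_r (Rpower (d / c) (/ p)) 1).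
assert (B3 := Rmax_l (Rpower (M / c) (/ p)) 1). assert (B4 := Rmax_r (Rpower (M / c) (/ p)) 1).
assert (A : c * Rpower a p < d).
{ replace d with (c * (d / c)) by (field; lra). apply Rmult_lt_compat_l; auto.
  apply Rpower_lt_inv; try lra. apply Rdiv_lt_0_compat; lra. }
assert (B : M < c * Rpower b p).
{ replace M with (c * (M / c)) by (field; lra). apply Rmult_lt_compat_l; auto.
  apply Rpower_gt_inv; try lra. apply Rdiv_lt_0_compat; lra. }
replace (RInt (fun x => c * (p * Rpower x (p - 1)) * f (c * Rpower x p)) a b)
  with (RInt f (c * Rpower a p) (c * Rpower b p)).
{ apply H1; auto. }
symmetry.
apply (RInt_comp f (fun x => c * Rpower x p) (fun x => c * (p * Rpower x (p - 1))) a b).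
- intros x Hx. rewrite Rmin_left in Hx by lra. apply Hf, Hg. lra.
- intros x Hx. rewrite Rmin_left in Hx by lra. split.
  + apply (is_derive_scal (fun x => Rpower x p)). apply is_derive_Rpower. lra.
  + apply P1. lra.
Qed.

(** * The Gamma function *)

Lemma exp_le_compat x y : x <= y -> exp x <= exp y.
Proof. intros [H|H]. left. now apply exp_increasing. rewrite H. apply Rle_refl. Qed.

Lemma filterlim_Rpower_0 p : 0 < p ->
  filterlim (fun x => Rpower x p) (at_right 0) (locally 0).
Proof.
intros Hp P [e He]. exists (mkposreal _ (Rpower_pos e (/ p))).
intros x Hx Hx0. change (Rabs (x - 0) < Rpower e (/ p)) in Hx.
rewrite Rminus_0_r, Rabs_pos_eq in Hx by lra.
apply He. change (Rabs (Rpower x p - 0) < e).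
rewrite Rminus_0_r, Rabs_pos_eq by (left; apply Rpower_pos).
apply Rpower_lt_inv; auto. apply e.
Qed.

Lemma filterlim_Rpower_p_infty p : 0 < p ->
  filterlim (fun x => Rpower x p) (Rbar_locally p_infty) (Rbar_locally p_infty).
Proof.
intros Hp P [M HM]. exists (Rpower (Rmax M 1) (/ p)). intros x Hx.
apply HM. apply Rle_lt_trans with (1 := Rmax_l M 1).
assert (B := Rmax_r M 1). apply Rpower_gt_inv; auto; try lra.
apply Rlt_trans with (2 := Hx). apply Rpower_pos.
Qed.

Lemma filterlim_Rinv_1p_p_infty :
  filterlim (fun y => - / (1 + y)) (Rbar_locally p_infty) (locally 0).
Proof.
intros P [e He]. assert (Hp := cond_pos e). exists (/ e). intros y Hy.
assert (0 < / e) by now apply Rinv_0_lt_compat.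
apply He. change (Rabs (- / (1 + y) - 0) < e).
rewrite Rminus_0_r, Rabs_Ropp, Rabs_pos_eq.
- rewrite <- (Rinv_inv e). apply Rinv_lt_contravar; nra.
- left. apply Rinv_0_lt_compat. lra.
Qed.

Lemma poscont_ex_derive f : (forall x, 0 < x -> ex_derive f x) -> poscont f.
Proof. intros H x Hx. apply (ex_derive_continuous (V := R_NormedModule)). auto. Qed.

Lemma Rpower_m1_l x p : 0 < x -> Rpower x p = x * Rpower x (p - 1).
Proof.
intros Hx. replace p with (1 + (p - 1)) at 1 by ring.
rewrite Rpower_plus, Rpower_1; auto.
Qed.

Lemma pint_Rpower_rational p : 0 < p ->
  pint (fun s => p * Rpower s (p - 1) * / (1 + Rpower s p) ^ 2) 1.
Proof.
intros Hp. apply pint_eq with (0 - (-1)). ring.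
assert (D : forall x, 0 < 1 + Rpower x p) by (intros x; assert (H := Rpower_pos x p); lra).
apply (pint_derive (fun s => - / (1 + Rpower s p))).
- intros x Hx.
  assert (H := is_derive_Rpower p x Hx).
  assert (H1 : is_derive (fun y => - / (1 + y)) (Rpower x p) (/ (1 + Rpower x p) ^ 2)).
  { specialize (D x). auto_derive. lra. field. lra. }
  apply (is_derive_comp (fun y => - / (1 + y)) (fun s => Rpower s p) x _ _ H1 H).
- apply poscont_ex_derive. intros x Hx. specialize (D x). unfold Rpower in *. auto_derive.
  repeat split; auto. apply Rgt_not_eq. apply Rmult_lt_0_compat; lra.
- apply (filterlim_comp _ _ _ (fun s => Rpower s p) (fun y => - / (1 + y)) _ (locally 0)).
  now apply filterlim_Rpower_0.
  replace (-1) with (- / (1 + 0)) by field.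
  apply (ex_derive_continuous (V := R_NormedModule) (fun y => - / (1 + y))).
  auto_derive. lra.
- apply (filterlim_comp _ _ _ (fun s => Rpower s p) (fun y => - / (1 + y)) _ (Rbar_locally p_infty)).
  now apply filterlim_Rpower_p_infty. apply filterlim_Rinv_1p_p_infty.
Qed.

Lemma Rpower_le_1 x p : 0 < x <= 1 -> 0 <= p -> Rpower x p <= 1.
Proof.
intros Hx Hp.
apply Rle_trans with (Rpower 1 p). apply Rle_Rpower_l; lra.
unfold Rpower. rewrite ln_1, Rmult_0_r, exp_0. lra.
Qed.

Lemma Rpower_ge_1 x p : 1 <= x -> 0 <= p -> 1 <= Rpower x p.
Proof.
intros Hx Hp. replace 1 with (Rpower 1 p). apply Rle_Rpower_l; lra.
unfold Rpower. rewrite ln_1, !Rmult_0_r. apply exp_0.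
Qed.

Lemma power_majorant p q : 0 < p -> 0 < q -> exists g L, poscont g /\ pint g L /\
  (forall s, 0 < s -> 0 <= g s) /\
  (forall s, 0 < s <= 1 -> Rpower s (p - 1) <= g s) /\
  (forall s, 1 <= s -> Rpower s (- q - 1) <= g s).
Proof.
intros Hp Hq.
set (k p s := 4 / p * (p * Rpower s (p - 1) * / (1 + Rpower s p) ^ 2)).
assert (K : forall p s, 0 < p -> 0 < k p s /\ k p s = 4 * Rpower s (p - 1) * / (1 + Rpower s p) ^ 2).
{ intros p' s Hp'. assert (H1 := Rpower_pos s p'). assert (H2 := Rpower_pos s (p' - 1)).
  assert (E : k p' s = 4 * Rpower s (p' - 1) * / (1 + Rpower s p') ^ 2)
   by (unfold k; field; lra).
  split; auto. rewrite E. apply Rmult_lt_0_compat. lra. apply Rinv_0_lt_compat.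
  apply pow_lt. lra. }
assert (C : forall p, 0 < p -> poscont (k p)).
{ intros p' Hp'. unfold k. apply poscont_scal. apply poscont_ex_derive. intros x Hx.
  assert (D : 0 < 1 + Rpower x p') by (assert (H := Rpower_pos x p'); lra).
  unfold Rpower in *. auto_derive.
  repeat split; auto. apply Rgt_not_eq. apply Rmult_lt_0_compat; lra. }
exists (fun s => k p s + k q s), (4 / p * 1 + 4 / q * 1). repeat split.
- apply poscont_plus; auto.
- apply pint_plus; apply pint_scal; now apply pint_Rpower_rational.
- intros s Hs. destruct (K p s Hp), (K q s Hq). lra.
- intros s Hs. destruct (K p s Hp) as [_ E], (K q s Hq) as [H _].
  apply Rle_trans with (k p s); [|lra]. rewrite E.
  assert (H1 := Rpower_pos s p). assert (H2 := Rpower_pos s (p - 1)).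
  assert (H3 := Rpower_le_1 s p Hs ltac:(lra)).
  assert (H4 : 0 < (1 + Rpower s p) ^ 2) by (apply pow_lt; lra).
  apply Rmult_le_reg_r with ((1 + Rpower s p) ^ 2); auto.
  rewrite (Rmult_assoc (4 * _)), Rinv_l, Rmult_1_r by lra.
  assert ((1 + Rpower s p) ^ 2 <= 4) by nra. nra.
- intros s Hs. destruct (K p s Hp) as [H _], (K q s Hq) as [_ E].
  apply Rle_trans with (k q s); [|lra]. rewrite E.
  assert (H1 := Rpower_pos s q).
  assert (H3 := Rpower_ge_1 s q Hs ltac:(lra)).
  replace (Rpower s (q - 1)) with (Rpower s (- q - 1) * (Rpower s q * Rpower s q)).
  2:{ rewrite <- !Rpower_plus. f_equal. ring. }
  assert (H4 := Rpower_pos s (- q - 1)).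
  set (A := Rpower s (- q - 1)) in *. set (w := Rpower s q) in *.
  apply Rmult_le_reg_r with ((1 + w) ^ 2). apply pow_lt; lra.
  rewrite (Rmult_assoc (4 * _)), Rinv_l, Rmult_1_r.
  2:{ apply pow_nonzero. lra. }
  assert (A * (1 + w) ^ 2 <= A * (4 * (w * w))).
  { apply Rmult_le_compat_l. lra. nra. }
  lra.
Qed.

Lemma Rpower_exp_le m c : 0 < m -> 0 < c ->
  exists C, 0 < C /\ forall s, 0 < s -> Rpower s m * exp (- (c * s)) <= C.
Proof.
intros Hm Hc. exists (exp (- m - m * ln (c / m))). split. apply exp_pos.
intros s Hs. unfold Rpower. rewrite <- exp_plus.
apply exp_le_compat.
assert (H0 : 0 < c / m) by (apply Rdiv_lt_0_compat; lra).
assert (H := exp_ineq1_le (ln (c / m * s))).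
rewrite exp_ln, ln_mult in H; auto.
2:{ now apply Rmult_lt_0_compat. }
apply Rmult_le_compat_l with (r := m) in H; [|lra].
replace (m * (c / m * s)) with (c * s) in H by (field; lra). lra.
Qed.

Definition Gamma_integrand (a s : R) : R := Rpower s (a - 1) * exp (- s).

Lemma poscont_Gamma_integrand a : poscont (Gamma_integrand a).
Proof.
apply poscont_ex_derive. intros x Hx. unfold Gamma_integrand, Rpower. now auto_derive.
Qed.

Lemma Gamma_integrand_pos a s : 0 < Gamma_integrand a s.
Proof. apply Rmult_lt_0_compat; apply exp_pos. Qed.

Lemma pint_Gamma a : 0 < a -> pint (Gamma_integrand a) (Gamma a).
Proof.
intros Ha.
destruct (power_majorant a 1 Ha Rlt_0_1) as [g [L [Hg [HL [Hg0 [Hg1 Hg2]]]]]].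
destruct (Rpower_exp_le (a + 1) 1 ltac:(lra) Rlt_0_1) as [C [HC HE]].
destruct (pint_dominated (Gamma_integrand a) (fun s => (1 + C) * g s) ((1 + C) * L))
  as [l Hl].
- apply poscont_Gamma_integrand.
- now apply poscont_scal.
- intros s Hs. rewrite Rabs_pos_eq by (left; apply Gamma_integrand_pos).
  unfold Gamma_integrand. specialize (Hg0 s Hs).
  assert (H1 := Rpower_pos s (a - 1)).
  destruct (Rle_dec s 1) as [H|H].
  + assert (H3 := Hg1 s ltac:(lra)).
    assert (exp (- s) <= 1) by (rewrite <- exp_0; apply exp_le_compat; lra).
    assert (H4 := exp_pos (- s)). nra.
  + assert (H3 := Hg2 s ltac:(lra)). specialize (HE s Hs).
    replace (a - 1) with (a + 1 + (- (1) - 1)) by ring. rewrite Rpower_plus.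
    rewrite Rmult_1_l in HE.
    assert (H4 := Rpower_pos s (- (1) - 1)).
    apply Rle_trans with (C * Rpower s (- (1) - 1)).
    * rewrite Rmult_assoc, (Rmult_comm (Rpower s (- (1) - 1))), <- Rmult_assoc. 
      apply Rmult_le_compat_r; lra.
    * nra.
- now apply pint_scal.
- assert (E : Gamma a = l).
  { exact (is_RInt_gen_unique (V := R_CompleteNormedModule) (Gamma_integrand a) l Hl). }
  now rewrite E.
Qed.

Lemma Gamma_pos a : 0 < a -> 0 < Gamma a.
Proof.
intros Ha. apply (pint_pos (Gamma_integrand a)).
apply poscont_Gamma_integrand. intros; apply Gamma_integrand_pos. now apply pint_Gamma.
Qed.

Lemma filterlim_Rpower_exp_p_infty a : 0 < a ->
  filterlim (fun s => Rpower s a * exp (- s)) (Rbar_locally p_infty) (locally 0).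
Proof.
intros Ha P [e He]. assert (Hp := cond_pos e).
destruct (Rpower_exp_le (a + 1) 1 ltac:(lra) Rlt_0_1) as [C [HC HE]].
exists (C / e). intros s Hs.
assert (0 < C / e) by (apply Rdiv_lt_0_compat; lra).
apply He. change (Rabs (Rpower s a * exp (- s) - 0) < e).
assert (H1 := Rpower_pos s a). assert (H2 := exp_pos (- s)).
rewrite Rminus_0_r, Rabs_pos_eq by nra.
specialize (HE s ltac:(lra)). rewrite Rmult_1_l, (Rpower_plus a 1), Rpower_1 in HE by lra.
assert (C < e * s).
{ replace C with (e * (C / e)) by (field; lra). apply Rmult_lt_compat_l; lra. }
apply Rmult_lt_reg_r with s; lra.
Qed.

Lemma Gamma_succ a : 0 < a -> Gamma (a + 1) = a * Gamma a.
Proof.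
intros Ha.
assert (H : pint (fun s => a * Gamma_integrand a s - Gamma_integrand (a + 1) s) (0 - 0)).
{ apply (pint_derive (fun s => Rpower s a * exp (- s))).
  - intros x Hx.
    replace (a * Gamma_integrand a x - Gamma_integrand (a + 1) x)
      with (a * Rpower x (a - 1) * exp (- x) + Rpower x a * (- exp (- x))).
    2:{ unfold Gamma_integrand. replace (a + 1 - 1) with a by ring. ring. }
    apply (is_derive_mult (fun s => Rpower s a) (fun s => exp (- s))).
    + now apply is_derive_Rpower.
    + auto_derive; auto. ring.
    + intros; apply Rmult_comm.
  - apply (poscont_plus (fun s => a * Gamma_integrand a s) (fun s => - Gamma_integrand (a + 1) s)).
    apply poscont_scal, poscont_Gamma_integrand.
    intros x Hx. apply (continuous_opp (V := R_NormedModule)). now apply poscont_Gamma_integrand.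
  - intros P [e He]. destruct (filterlim_Rpower_0 a Ha _ (locally_ball 0 e)) as [d Hd].
    exists d. intros x Hx Hx0. apply He. specialize (Hd x Hx Hx0).
    change (Rabs (Rpower x a - 0) < e) in Hd.
    change (Rabs (Rpower x a * exp (- x) - 0) < e).
    rewrite Rminus_0_r in *. rewrite Rabs_mult, (Rabs_pos_eq (exp _)) by (left; apply exp_pos).
    assert (exp (- x) <= 1) by (rewrite <- exp_0; apply exp_le_compat; lra).
    assert (H4 := exp_pos (- x)). assert (H5 := Rabs_pos (Rpower x a)). nra.
  - now apply filterlim_Rpower_exp_p_infty. }
assert (H' := pint_minus _ _ _ _ (pint_scal _ a _ (pint_Gamma a Ha)) (pint_Gamma (a + 1) ltac:(lra))).
assert (E := pint_unique _ _ _ H H'). lra.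
Qed.

Lemma Gamma_1 : Gamma 1 = 1.
Proof.
apply (pint_unique (Gamma_integrand 1)). apply pint_Gamma; lra.
apply pint_eq with (0 - (- exp (- 0))). rewrite Ropp_0, exp_0; ring.
apply (pint_derive (fun s => - exp (- s))).
- intros x Hx. unfold Gamma_integrand. rewrite Rminus_diag, Rpower_O by auto.
  auto_derive; auto; ring.
- apply poscont_Gamma_integrand.
- apply (filterlim_filter_le_1 (F := locally 0)). apply filter_le_within.
  apply (ex_derive_continuous (V := R_NormedModule) (fun s => - exp (- s))). now auto_derive.
- intros P [e He]. 
  destruct (filterlim_Rpower_exp_p_infty 1 Rlt_0_1 _ (locally_ball 0 e)) as [M HM].
  exists (Rmax M 1). intros x Hx. apply He.
  assert (B1 := Rmax_l M 1). assert (B2 := Rmax_r M 1). specialize (HM x ltac:(lra)).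
  change (Rabs (Rpower x 1 * exp (- x) - 0) < e) in HM. change (Rabs (- exp (- x) - 0) < e).
  rewrite Rminus_0_r in *. rewrite Rpower_1, Rabs_mult in HM by lra.
  rewrite Rabs_Ropp. rewrite (Rabs_pos_eq x) in HM by lra.
  assert (H5 := Rabs_pos (exp (- x))). nra.
Qed.

(** * Rotation of the Gamma integral *)

Ltac continuity_2d :=
  match goal with
  | |- continuity_2d_pt (fun x y => ?f) _ _ =>
      lazymatch type of f with R => apply continuity_2d_pt_const end
  | |- continuity_2d_pt (fun x _ => x) _ _ => apply continuity_2d_pt_id1
  | |- continuity_2d_pt (fun _ y => y) _ _ => apply continuity_2d_pt_id2
  | |- continuity_2d_pt (fun x y => @?f x y * @?g x y) _ _ =>
      apply (continuity_2d_pt_mult f g); continuity_2d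
  | |- continuity_2d_pt (fun x y => @?f x y + @?g x y) _ _ =>
      apply (continuity_2d_pt_plus f g); continuity_2d
  | |- continuity_2d_pt (fun x y => @?f x y - @?g x y) _ _ =>
      apply (continuity_2d_pt_minus f g); continuity_2d
  | |- continuity_2d_pt (fun x y => - @?f x y) _ _ =>
      apply (continuity_2d_pt_opp f); continuity_2d
  | |- continuity_2d_pt (fun x y => Rpower (@?f x y) ?p) _ _ =>
      apply (continuity_1d_2d_pt_comp (fun z => Rpower z p) f);
        [ try (apply continuity_pt_filterlim; apply poscont_Rpower; lra) | continuity_2d ]
  | |- continuity_2d_pt (fun x y => ?h (@?f x y)) _ _ =>
      apply (continuity_1d_2d_pt_comp h f);
        [ try (apply derivable_continuous_pt, derivable_pt_exp);
          try apply continuity_sin; try apply continuity_cos | continuity_2d ]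
  | _ => idtac
  end.

(* The real part of e^(-ib) z^(a-1) e^(-z) dz/dr along the ray z = r e^(i phi). Its derivative
   in [phi] and the derivative of [ray_primitive] in [r] are both [ray_deriv], which makes the
   integral independent of [phi]. *)
Definition ray_integrand (a b phi r : R) : R :=
  Rpower r (a - 1) * exp (- (r * cos phi)) * cos (r * sin phi - a * phi + b).

Definition ray_primitive (a b phi r : R) : R :=
  Rpower r a * exp (- (r * cos phi)) * sin (r * sin phi - a * phi + b).

Definition ray_deriv (a b phi r : R) : R :=
  Rpower r (a - 1) * exp (- (r * cos phi)) *
  (r * sin phi * cos (r * sin phi - a * phi + b)
   - sin (r * sin phi - a * phi + b) * (r * cos phi - a)).

Lemma is_derive_ray_integrand_angle a b phi r :
  is_derive (fun p => ray_integrand a b p r) phi (ray_deriv a b phi r).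
Proof. unfold ray_integrand, ray_deriv, Rminus. auto_derive; auto. ring. Qed.

Lemma is_derive_ray_primitive a b phi r : 0 < r ->
  is_derive (ray_primitive a b phi) r (ray_deriv a b phi r).
Proof.
intros Hr. unfold ray_primitive, ray_deriv.
assert (D := is_derive_Rpower a r Hr).
assert (D2 : is_derive (fun r => exp (- (r * cos phi)) * sin (r * sin phi - a * phi + b)) r
  (exp (- (r * cos phi)) * (sin phi * cos (r * sin phi - a * phi + b) -
    cos phi * sin (r * sin phi - a * phi + b)))).
{ unfold Rminus. auto_derive; auto. ring. }
apply is_derive_ext with (fun r => Rpower r a *
  (exp (- (r * cos phi)) * sin (r * sin phi - a * phi + b))).
{ intros t. symmetry. apply Rmult_assoc. }
replace (Rpower r (a - 1) * exp (- (r * cos phi)) * _)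
 with (a * Rpower r (a - 1) * (exp (- (r * cos phi)) * sin (r * sin phi - a * phi + b)) +
  Rpower r a * (exp (- (r * cos phi)) * (sin phi * cos (r * sin phi - a * phi + b) -
    cos phi * sin (r * sin phi - a * phi + b)))).
2:{ rewrite (Rpower_m1_l r a Hr). ring. }
apply (is_derive_mult (fun r => Rpower r a) _ r _ _ D D2).
intros; apply Rmult_comm.
Qed.

Lemma continuity_2d_ray_deriv a b phi r : 0 < r -> continuity_2d_pt (ray_deriv a b) phi r.
Proof. intros Hr. unfold ray_deriv. continuity_2d. Qed.

Lemma poscont_ray_integrand a b phi : poscont (ray_integrand a b phi).
Proof.
apply poscont_ex_derive. intros x Hx. unfold ray_integrand, Rpower. now auto_derive.
Qed.

Lemma poscont_ray_deriv a b phi : poscont (ray_deriv a b phi).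
Proof.
apply poscont_ex_derive. intros x Hx. unfold ray_deriv, Rpower. now auto_derive.
Qed.

Lemma is_derive_RInt_ray_integrand a b m n phi : 0 < m -> 0 < n ->
  is_derive (fun p => RInt (ray_integrand a b p) m n) phi
    (ray_primitive a b phi n - ray_primitive a b phi m).
Proof.
intros Hm Hn.
assert (Hmin : 0 < Rmin m n) by now apply Rmin_glb_lt.
replace (ray_primitive a b phi n - ray_primitive a b phi m)
  with (RInt (fun r => Derive (fun u => ray_integrand a b u r) phi) m n).
- apply is_derive_RInt_param.
  + apply filter_forall. intros p r _. eexists. apply is_derive_ray_integrand_angle.
  + intros r Hr. apply continuity_2d_pt_ext with (ray_deriv a b).
    * intros p r'. symmetry. apply is_derive_unique, is_derive_ray_integrand_angle.
    * apply continuity_2d_ray_deriv. lra.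
  + apply filter_forall. intros p. apply poscont_ex_RInt; auto. apply poscont_ray_integrand.
- rewrite (RInt_ext _ (ray_deriv a b phi)).
  2:{ intros r _. apply is_derive_unique, is_derive_ray_integrand_angle. }
  apply is_RInt_unique. apply (is_RInt_derive (ray_primitive a b phi) (ray_deriv a b phi)).
  + intros r Hr. apply is_derive_ray_primitive. lra.
  + intros r Hr. apply poscont_ray_deriv. lra.
Qed.

Lemma RInt_ray_integrand_diff a b m n phi : 0 < m -> 0 < n -> 0 <= phi < PI / 2 ->
  Rabs (RInt (ray_integrand a b phi) m n - RInt (ray_integrand a b 0) m n) <=
  (Rpower n a * exp (- (n * cos phi)) + Rpower m a) * phi.
Proof.
intros Hm Hn Hphi.
assert (HP := PI_RGT_0).
replace phi with (Rabs (phi - 0)) at 3 by (rewrite Rminus_0_r, Rabs_pos_eq; lra).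
apply (bounded_variation (fun p => RInt (ray_integrand a b p) m n)
  (fun p => ray_primitive a b p n - ray_primitive a b p m)).
intros t Ht. rewrite !Rminus_0_r, (Rabs_pos_eq phi) in Ht by lra.
split. now apply is_derive_RInt_ray_integrand.
assert (Hc : cos phi <= cos t).
{ destruct (Rle_dec 0 t).
  - rewrite Rabs_pos_eq in Ht by auto. apply cos_decr_1; lra.
  - rewrite Rabs_left in Ht by lra. rewrite <- (cos_neg t). apply cos_decr_1; lra. }
assert (Hc0 : 0 <= cos phi) by (apply cos_ge_0; lra).
assert (B : forall r, 0 < r -> Rabs (ray_primitive a b t r) <= Rpower r a * exp (- (r * cos phi))).
{ intros r Hr. unfold ray_primitive. rewrite Rabs_mult, Rabs_pos_eq.
  2:{ left. apply Rmult_lt_0_compat; apply exp_pos. }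
  assert (S := SIN_bound (r * sin t - a * t + b)).
  assert (Rabs (sin (r * sin t - a * t + b)) <= 1) by (apply Rabs_le; lra).
  assert (H2 := Rabs_pos (sin (r * sin t - a * t + b))).
  assert (H3 : exp (- (r * cos t)) <= exp (- (r * cos phi))) by (apply exp_le_compat; nra).
  assert (H4 := Rpower_pos r a). assert (H5 := exp_pos (- (r * cos t))).
  assert (0 < Rpower r a * exp (- (r * cos t))) by now apply Rmult_lt_0_compat.
  apply Rle_trans with (Rpower r a * exp (- (r * cos t)) * 1).
  apply Rmult_le_compat_l; lra. rewrite Rmult_1_r. apply Rmult_le_compat_l; lra. }
unfold Rminus at 1. apply Rle_trans with (1 := Rabs_triang _ _). rewrite Rabs_Ropp.
apply Rplus_le_compat. now apply B.
apply Rle_trans with (1 := B m Hm).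
assert (exp (- (m * cos phi)) <= 1) by (rewrite <- exp_0; apply exp_le_compat; nra).
assert (H4 := Rpower_pos m a). nra.
Qed.

(* The integral of z^(a-1) e^(-z) over the ray of argument [phi] equals the one over the
   positive axis; the phase [b] selects a combination of its real and imaginary parts. *)
Lemma pint_Gamma_ray a b phi : 0 < a -> 0 <= phi < PI / 2 ->
  pint (fun r => Rpower r (a - 1) * exp (- (r * cos phi)) * cos (r * sin phi - a * phi + b))
    (Gamma a * cos b).
Proof.
intros Ha Hphi.
set (E := fun phi r => Rpower r (a - 1) * exp (- (r * cos phi)) * cos (r * sin phi - a * phi + b)).
assert (CE : forall phi, poscont (E phi)) by (intros; apply poscont_ray_integrand).
assert (H0 : pint (E 0) (Gamma a * cos b)).
{ rewrite Rmult_comm. apply pint_ext with (fun r => cos b * Gamma_integrand a r).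
  - intros x Hx. unfold E, Gamma_integrand. rewrite cos_0, sin_0.
    replace (x * 0 - a * 0 + b) with b by ring. rewrite Rmult_1_r. ring.
  - apply pint_scal. now apply pint_Gamma. }
change (pint (E phi) (Gamma a * cos b)).
apply pintP; auto. intros eps He.
assert (Hc : 0 < cos phi) by (apply cos_gt_0; lra).
destruct (proj1 (pintP _ _ (CE 0)) H0 (eps / 2) ltac:(lra)) as [d [M [[[Hd Hd1] HM] H1]]].
destruct (Rpower_exp_le (a + 1) (cos phi) ltac:(lra) Hc) as [C [HC HE]].
assert (HP := PI_4).
set (e := eps / 8). assert (He' : 0 < e) by (unfold e; lra).
assert (D := Rpower_pos e (/ a)).
assert (0 < C / e) by (apply Rdiv_lt_0_compat; lra).
exists (Rmin d (Rpower e (/ a))), (Rmax M (C / e)).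
assert (B1 := Rmin_l d (Rpower e (/ a))). assert (B2 := Rmin_r d (Rpower e (/ a))).
assert (B3 := Rmax_l M (C / e)). assert (B4 := Rmax_r M (C / e)).
split. { split; [split|]; try lra. apply Rmin_glb_lt; lra. }
intros m n Hm Hn. specialize (H1 m n ltac:(lra) ltac:(lra)).
assert (H2 := RInt_ray_integrand_diff a b m n phi ltac:(lra) ltac:(lra) Hphi).
change (Rabs (RInt (E phi) m n - RInt (E 0) m n) <=
  (Rpower n a * exp (- (n * cos phi)) + Rpower m a) * phi) in H2.
assert (H3 : Rpower m a < e) by (apply Rpower_lt_inv; lra).
assert (H4 : Rpower n a * exp (- (n * cos phi)) < e).
{ specialize (HE n ltac:(lra)). rewrite (Rpower_plus a 1), Rpower_1 in HE by lra.
  rewrite (Rmult_comm n).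
  assert (C < e * n).
  { replace C with (e * (C / e)) by (field; lra). apply Rmult_lt_compat_l; lra. }
  apply Rmult_lt_reg_r with n; lra. }
assert (H5 := Rpower_pos m a).
assert (H6 : 0 < Rpower n a * exp (- (n * cos phi)))
  by (apply Rmult_lt_0_compat; apply exp_pos).
assert (H7 : (Rpower n a * exp (- (n * cos phi)) + Rpower m a) * phi <= 2 * e * 2).
{ apply Rmult_le_compat; lra. }
apply Rabs_def2 in H1. apply Rabs_le_between in H2. unfold e in H7.
apply Rabs_def1; lra.
Qed.

Lemma pint_Gamma_kernel a z phi : 0 < a -> 0 < z -> 0 <= phi < PI / 2 ->
  pint (fun r => Rpower r (a - 1) * (exp (- (r * z * cos phi)) * cos (r * z * sin phi)))
    (Gamma a * Rpower z (- a) * cos (a * phi)).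
Proof.
intros Ha Hz Hphi.
assert (H := pint_Gamma_ray a (a * phi) phi Ha Hphi).
assert (C : poscont (fun r => Rpower r (a - 1) * exp (- (r * cos phi)) *
  cos (r * sin phi - a * phi + a * phi))).
{ apply poscont_ex_derive. intros x Hx. unfold Rpower. now auto_derive. }
apply (pint_subst_Rpower _ _ z 1 Hz Rlt_0_1) in H; auto.
apply (pint_scal _ (Rpower z (- a))) in H.
apply pint_eq with (Rpower z (- a) * (Gamma a * cos (a * phi))). ring.
revert H. apply pint_ext. intros x Hx. cbv beta. rewrite Rminus_diag, Rpower_O, (Rpower_1 x) by auto.
rewrite (Rmult_comm x z), <- Rpower_mult_distr by auto.
replace (z * x * sin phi - a * phi + a * phi) with (z * x * sin phi) by ring.
rewrite Rpower_Ropp, (Rpower_m1_l z a Hz).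
assert (Hp := Rpower_pos z (a - 1)). field. lra.
Qed.

(** * The reflection formula *)

Lemma filterlim_exp_p_infty c : 0 < c ->
  filterlim (fun s => exp (- (c * s))) (Rbar_locally p_infty) (locally 0).
Proof.
intros Hc P [e He]. assert (Hp := cond_pos e). exists (- ln e / c). intros s Hs.
apply He. change (Rabs (exp (- (c * s)) - 0) < e).
rewrite Rminus_0_r, Rabs_pos_eq by (left; apply exp_pos).
rewrite <- (exp_ln e) by auto. apply exp_increasing.
apply Rmult_lt_compat_l with (r := c) in Hs; auto.
replace (c * (- ln e / c)) with (- ln e) in Hs by (field; lra). lra.
Qed.

Lemma pint_exp_cos al be : 0 < al ->
  pint (fun s => exp (- (al * s)) * cos (be * s)) (al / (al ^ 2 + be ^ 2)).
Proof.
intros Hal. assert (HD : 0 < al ^ 2 + be ^ 2) by nra.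
set (G s := exp (- (al * s)) * (be * sin (be * s) - al * cos (be * s)) / (al ^ 2 + be ^ 2)).
apply pint_eq with (0 - G 0).
{ unfold G. rewrite !Rmult_0_r, Ropp_0, exp_0, sin_0, cos_0. field. lra. }
apply (pint_derive G).
- intros x Hx. unfold G. auto_derive. lra. field. lra.
- apply poscont_ex_derive. intros x Hx. now auto_derive.
- apply (filterlim_filter_le_1 (F := locally 0)). apply filter_le_within.
  apply (ex_derive_continuous (V := R_NormedModule) G). unfold G. auto_derive. lra.
- intros P [e He]. assert (Hp := cond_pos e).
  set (C := (Rabs be + al) / (al ^ 2 + be ^ 2)).
  assert (HC : 0 < C).
  { apply Rdiv_lt_0_compat; auto. assert (H := Rabs_pos be). lra. }
  assert (He' : 0 < e / C) by (apply Rdiv_lt_0_compat; auto).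
  destruct (filterlim_exp_p_infty al Hal _ (locally_ball 0 (mkposreal _ He'))) as [M HM].
  exists M. intros s Hs. apply He. specialize (HM s Hs).
  change (Rabs (exp (- (al * s)) - 0) < e / C) in HM. change (Rabs (G s - 0) < e).
  rewrite Rminus_0_r in *. rewrite Rabs_pos_eq in HM by (left; apply exp_pos).
  unfold G, Rdiv. rewrite !Rabs_mult, (Rabs_pos_eq (exp _)), (Rabs_pos_eq (/ _)).
  2:{ left. now apply Rinv_0_lt_compat. } 2:{ left. apply exp_pos. }
  assert (T : Rabs (be * sin (be * s) - al * cos (be * s)) <= Rabs be + al).
  { unfold Rminus. apply Rle_trans with (1 := Rabs_triang _ _).
    rewrite Rabs_Ropp, !Rabs_mult, (Rabs_pos_eq al) by lra.
    assert (S1 := SIN_bound (be * s)). assert (S2 := COS_bound (be * s)).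
    assert (Rabs (sin (be * s)) <= 1) by (apply Rabs_le; lra).
    assert (Rabs (cos (be * s)) <= 1) by (apply Rabs_le; lra).
    assert (H2 := Rabs_pos be). nra. }
  apply Rle_lt_trans with (exp (- (al * s)) * C).
  + unfold C, Rdiv. rewrite Rmult_assoc. apply Rmult_le_compat_l. left; apply exp_pos.
    apply Rmult_le_compat_r; auto. left. now apply Rinv_0_lt_compat.
  + apply Rlt_le_trans with (e / C * C). apply Rmult_lt_compat_r; auto. right; field; lra.
Qed.

Lemma ex_derive_continuity_pt f x : ex_derive f x -> continuity_pt f x.
Proof.
intros H. apply continuity_pt_filterlim. now apply (ex_derive_continuous (V := R_NormedModule)).
Qed.

Definition beta_kernel (a phi r : R) : R :=
  Rpower r (a - 1) * ((1 + r * cos phi) / ((1 + r * cos phi) ^ 2 + (r * sin phi) ^ 2)).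

Lemma beta_kernel_den r phi :
  (1 + r * cos phi) ^ 2 + (r * sin phi) ^ 2 = 1 + 2 * r * cos phi + r ^ 2.
Proof.
assert (H := sin2_cos2 phi). unfold Rsqr in H.
replace ((1 + r * cos phi) ^ 2 + (r * sin phi) ^ 2)
  with (1 + 2 * r * cos phi + r ^ 2 * (sin phi * sin phi + cos phi * cos phi)) by ring.
rewrite H. ring.
Qed.

Lemma poscont_beta_kernel a phi : 0 <= cos phi -> poscont (beta_kernel a phi).
Proof.
intros Hc. apply poscont_ex_derive. intros x Hx. unfold beta_kernel, Rpower.
assert (D : 0 < (1 + x * cos phi) ^ 2 + (x * sin phi) ^ 2).
{ assert (H1 : 1 <= 1 + x * cos phi) by nra.
  assert (H2 := pow2_ge_0 (x * sin phi)). nra. }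
auto_derive. repeat split; auto. apply Rgt_not_eq. lra.
Qed.

Lemma pint_beta_kernel a phi : 0 < a < 1 -> 0 <= phi < PI / 2 ->
  pint (beta_kernel a phi) (Gamma a * Gamma (1 - a) * cos (a * phi)).
Proof.
intros Ha Hphi. assert (HP := PI_RGT_0).
assert (Hc : 0 < cos phi) by (apply cos_gt_0; lra).
set (b := (1 + a) / 2).
destruct (power_majorant a (b - a) ltac:(lra) ltac:(unfold b; lra))
  as [g [G [Hg [HG [Hg0 [Hg1 Hg2]]]]]].
destruct (Rpower_exp_le b (cos phi) ltac:(unfold b; lra) Hc) as [C [HC HE]].
set (F r s := exp (- s) * (Rpower r (a - 1) * (exp (- (r * s * cos phi)) * cos (r * s * sin phi)))).
set (A s := Gamma a * cos (a * phi) * Gamma_integrand (1 - a) s).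
destruct (pint_fubini F g (fun s => Gamma_integrand 1 s + C * Gamma_integrand (1 - b) s)
  G (Gamma 1 + C * Gamma (1 - b)) A (beta_kernel a phi)) as [l [HA HB]]; auto.
- intros x y Hx Hy. unfold F. continuity_2d.
- apply poscont_plus; [|apply poscont_scal]; apply poscont_Gamma_integrand.
- apply poscont_scal, poscont_Gamma_integrand.
- apply poscont_beta_kernel; lra.
- intros y Hy. assert (H1 := Gamma_integrand_pos 1 y).
  assert (H2 := Gamma_integrand_pos (1 - b) y). nra.
- intros r s Hr Hs. unfold F, Gamma_integrand.
  replace (1 - b - 1) with (- b) by ring. rewrite Rminus_diag, Rpower_O, Rmult_1_l by auto.
  specialize (Hg0 r Hr).
  assert (Hrs : 0 < r * s) by now apply Rmult_lt_0_compat.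
  assert (P1 := Rpower_pos r (a - 1)). assert (P2 := exp_pos (- s)).
  assert (P3 := exp_pos (- (r * s * cos phi))). assert (P4 := Rpower_pos s (- b)).
  assert (S2 := COS_bound (r * s * sin phi)).
  assert (S3 : Rabs (cos (r * s * sin phi)) <= 1) by (apply Rabs_le; lra).
  apply Rle_trans with (exp (- s) * (Rpower r (a - 1) * exp (- (r * s * cos phi)))).
  { rewrite !Rabs_mult, !Rabs_pos_eq by lra. apply Rmult_le_compat_l. lra.
    apply Rmult_le_compat_l. lra. assert (H := Rabs_pos (cos (r * s * sin phi))). nra. }
  rewrite Rmult_comm.
  replace (g r * (exp (- s) + C * (Rpower s (- b) * exp (- s))))
    with (g r * (1 + C * Rpower s (- b)) * exp (- s)) by ring.
  apply Rmult_le_compat_r. lra.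
  assert (P5 : 0 < C * Rpower s (- b)) by now apply Rmult_lt_0_compat.
  destruct (Rle_dec r 1) as [H|H].
  + assert (H3 := Hg1 r ltac:(lra)).
    assert (exp (- (r * s * cos phi)) <= 1).
    { rewrite <- exp_0; apply exp_le_compat. nra. }
    nra.
  + assert (H3 := Hg2 r ltac:(lra)).
    specialize (HE (r * s) Hrs).
    rewrite <- Rpower_mult_distr in HE by auto.
    assert (P6 := Rpower_pos r b). assert (P7 := Rpower_pos s b).
    apply Rle_trans with (Rpower r (- (b - a) - 1) * (C * Rpower s (- b))); [|nra].
    replace (- (b - a) - 1) with (a - 1 + - b) by ring.
    rewrite Rpower_plus, (Rmult_assoc (Rpower r (a - 1))). apply Rmult_le_compat_l. lra.
    rewrite !Rpower_Ropp.
    apply Rmult_le_reg_r with (Rpower r b * Rpower s b). now apply Rmult_lt_0_compat.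
    replace (/ Rpower r b * (C * / Rpower s b) * (Rpower r b * Rpower s b)) with C by (field; lra).
    rewrite (Rmult_comm (cos phi)) in HE. lra.
- apply pint_plus; [|apply pint_scal]; apply pint_Gamma; unfold b; lra.
- intros s Hs. unfold F, A, Gamma_integrand.
  replace (1 - a - 1) with (- a) by ring.
  apply pint_eq with (exp (- s) * (Gamma a * Rpower s (- a) * cos (a * phi))). ring.
  apply pint_scal. apply pint_Gamma_kernel; lra.
- intros r Hr. unfold F, beta_kernel.
  apply pint_ext with (fun s => Rpower r (a - 1) *
    (exp (- ((1 + r * cos phi) * s)) * cos (r * sin phi * s))).
  + intros s Hs. replace (- ((1 + r * cos phi) * s)) with (- s + - (r * s * cos phi)) by ring.
    rewrite exp_plus. replace (r * sin phi * s) with (r * s * sin phi) by ring. ring.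
  + apply pint_scal. apply pint_exp_cos. nra.
- assert (HA' : pint A (Gamma a * cos (a * phi) * Gamma (1 - a))).
  { apply pint_scal. apply pint_Gamma. lra. }
  rewrite (pint_unique _ _ _ HA HA') in HB.
  apply pint_eq with (2 := HB). ring.
Qed.

Lemma is_lim_seq_half_pi :
  is_lim_seq (fun n => PI / 2 - / (INR n + 1)) (PI / 2).
Proof.
replace (Finite (PI / 2)) with (Finite (PI / 2 - 0)) by (f_equal; ring).
apply is_lim_seq_minus'. apply is_lim_seq_const.
replace (Finite 0) with (Rbar_inv p_infty) by reflexivity.
apply is_lim_seq_inv; [|discriminate].
apply is_lim_seq_ext with (fun n => INR (S n)).
intros; now rewrite S_INR. apply (is_lim_seq_incr_1 INR). apply is_lim_seq_INR.
Qed.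

Lemma half_pi_seq_bounds n :
  0 <= PI / 2 - / (INR n + 1) < PI / 2 /\
  0 <= cos (PI / 2 - / (INR n + 1)) <= / (INR n + 1).
Proof.
assert (H0 := pos_INR n).
assert (H1 : 0 < / (INR n + 1)) by (apply Rinv_0_lt_compat; lra).
assert (H2 : / (INR n + 1) <= 1) by (rewrite <- Rinv_1 at 2; apply Rinv_le_contravar; lra).
assert (HP := PI2_1). assert (HP1 := PI_RGT_0).
split. lra. rewrite cos_shift. split. apply sin_ge_0; lra. left. now apply sin_lt_x.
Qed.

Lemma pint_beta_half a : 0 < a < 1 ->
  pint (fun r => Rpower r (a - 1) * / (1 + r ^ 2))
    (Gamma a * Gamma (1 - a) * cos (a * (PI / 2))).
Proof.
intros Ha.
destruct (power_majorant a (1 - a) ltac:(lra) ltac:(lra))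
  as [g [G [Hg [HG [Hg0 [Hg1 Hg2]]]]]].
set (ph n := PI / 2 - / (INR n + 1)).
assert (Hph : forall n, 0 <= ph n < PI / 2 /\ 0 <= cos (ph n) <= / (INR n + 1))
  by exact half_pi_seq_bounds.
destruct (pint_lim (fun n => beta_kernel a (ph n)) (fun r => Rpower r (a - 1) * / (1 + r ^ 2))
  (fun r => 2 * g r) (fun n => Gamma a * Gamma (1 - a) * cos (a * ph n)) (2 * G))
  as [l [Hl Hlim]].
- intros n. apply poscont_beta_kernel. apply Hph.
- apply poscont_ex_derive. intros x Hx. unfold Rpower. auto_derive.
  repeat split; auto. apply Rgt_not_eq. nra.
- now apply poscont_scal.
- now apply pint_scal.
- intros n r Hr. destruct (Hph n) as [_ [Hc _]].
  unfold beta_kernel. rewrite beta_kernel_den.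
  assert (Hc1 := COS_bound (ph n)).
  assert (P1 := Rpower_pos r (a - 1)). specialize (Hg0 r Hr).
  assert (D : 0 < 1 + 2 * r * cos (ph n) + r ^ 2) by nra.
  assert (N : 0 < 1 + r * cos (ph n)) by nra.
  assert (Q : 0 < (1 + r * cos (ph n)) / (1 + 2 * r * cos (ph n) + r ^ 2))
    by now apply Rdiv_lt_0_compat.
  rewrite Rabs_pos_eq by nra.
  destruct (Rle_dec r 1) as [H|H].
  + assert (H3 := Hg1 r ltac:(lra)).
    assert ((1 + r * cos (ph n)) / (1 + 2 * r * cos (ph n) + r ^ 2) <= 2).
    { apply Rle_div_l; auto. nra. }
    nra.
  + assert (H3 := Hg2 r ltac:(lra)).
    apply Rle_trans with (2 * Rpower r (- (1 - a) - 1)); [|lra].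
    replace (- (1 - a) - 1) with (a - 1 + - (1)) by ring.
    rewrite Rpower_plus, Rpower_Ropp, (Rpower_1 r) by auto.
    replace (2 * (Rpower r (a - 1) * / r)) with (Rpower r (a - 1) * (2 / r)) by (field; lra).
    apply Rmult_le_compat_l. lra.
    apply Rle_div_l; auto. replace (2 / r * (1 + 2 * r * cos (ph n) + r ^ 2))
      with (2 / r + 4 * cos (ph n) + 2 * r) by (field; lra).
    assert (0 < 2 / r) by (apply Rdiv_lt_0_compat; lra). nra.
- intros m M eps HmM He.
  assert (P1 := Rpower_pos M a).
  destruct (nfloor_ex (Rpower M a / eps)) as [N HN].
  { left. now apply Rdiv_lt_0_compat. }
  exists N. intros n Hn r Hr. destruct (Hph n) as [_ [Hc0 Hc]].
  unfold beta_kernel. rewrite beta_kernel_den.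
  set (c := cos (ph n)) in *.
  assert (D : 1 + r ^ 2 <= 1 + 2 * r * c + r ^ 2) by nra.
  assert (D1 : 0 < 1 + r ^ 2) by nra.
  replace (Rpower r (a - 1) * ((1 + r * c) / (1 + 2 * r * c + r ^ 2)) - Rpower r (a - 1) * / (1 + r ^ 2))
    with (r * Rpower r (a - 1) * c * ((r ^ 2 - 1) / ((1 + 2 * r * c + r ^ 2) * (1 + r ^ 2))))
    by (field; nra).
  rewrite <- Rpower_m1_l by lra.
  assert (B : Rabs ((r ^ 2 - 1) / ((1 + 2 * r * c + r ^ 2) * (1 + r ^ 2))) <= 1).
  { assert (0 < (1 + 2 * r * c + r ^ 2) * (1 + r ^ 2)) by nra.
    unfold Rdiv. rewrite Rabs_mult, (Rabs_pos_eq (/ _)).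
    2:{ left. now apply Rinv_0_lt_compat. }
    apply Rle_div_l; auto. apply Rabs_le. nra. }
  rewrite Rabs_mult. assert (P2 := Rpower_pos r a). rewrite Rabs_pos_eq by nra.
  assert (P3 : Rpower r a <= Rpower M a) by (apply Rle_Rpower_l; lra).
  assert (P4 := Rabs_pos ((r ^ 2 - 1) / ((1 + 2 * r * c + r ^ 2) * (1 + r ^ 2)))).
  assert (P0 := pos_INR n).
  apply Rle_lt_trans with (Rpower M a * / (INR n + 1)).
  + apply Rle_trans with (Rpower r a * c * 1).
    { apply Rmult_le_compat_l; auto. apply Rmult_le_pos; lra. }
    rewrite Rmult_1_r. apply Rmult_le_compat; lra.
  + apply Rlt_div_l. lra.
    apply le_INR in Hn. destruct HN as [_ HN].
    assert (H7 : Rpower M a / eps < INR n + 1) by lra.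
    apply Rlt_div_l in H7; auto. lra.
- intros n. apply pint_beta_kernel; auto. apply Hph.
- assert (Hlim' : is_lim_seq (fun n => Gamma a * Gamma (1 - a) * cos (a * ph n))
     (Gamma a * Gamma (1 - a) * cos (a * (PI / 2)))).
  { apply (is_lim_seq_continuous (fun x => Gamma a * Gamma (1 - a) * cos (a * x)) ph (PI / 2)).
    2:{ apply is_lim_seq_half_pi. }
    apply ex_derive_continuity_pt. now auto_derive. }
  apply is_lim_seq_unique in Hlim. apply is_lim_seq_unique in Hlim'.
  rewrite Hlim in Hlim'. injection Hlim' as <-. exact Hl.
Qed.

Lemma Gamma_prod_half a : 0 < a < 1 ->
  Gamma (a / 2) * Gamma (1 - a / 2) = 2 * (Gamma a * Gamma (1 - a) * cos (a * (PI / 2))).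
Proof.
intros Ha. assert (HP := PI_RGT_0).
assert (H := pint_beta_kernel (a / 2) 0 ltac:(lra) ltac:(lra)).
apply (pint_subst_Rpower _ _ 1 2 Rlt_0_1 ltac:(lra)) in H.
2:{ apply poscont_beta_kernel. rewrite cos_0. lra. }
rewrite Rmult_0_r, cos_0, Rmult_1_r in H.
apply (pint_unique _ _ _ H).
apply pint_ext with (2 := pint_scal _ 2 _ (pint_beta_half a Ha)).
intros x Hx. unfold beta_kernel. rewrite cos_0, sin_0, !Rmult_1_l, !Rmult_1_r, Rmult_0_r.
replace (2 - 1) with 1 by ring. rewrite Rpower_mult.
replace (2 * (a / 2 - 1)) with (a - 1 + - (1)) by field.
rewrite Rpower_plus, Rpower_Ropp, Rpower_1 by auto.
replace (Rpower x 2) with (x ^ 2) by (rewrite <- (Rpower_pow 2 x Hx); f_equal; simpl; ring).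
field. nra.
Qed.

(* Gamma a * Gamma (1 - a) * sin (PI * a) is invariant under a -> a / 2, so it equals its limit
   PI at a = 0. *)
Lemma Gamma_sin_half a : 0 < a < 1 ->
  Gamma (a / 2) * Gamma (1 - a / 2) * sin (PI * (a / 2)) =
  Gamma a * Gamma (1 - a) * sin (PI * a).
Proof.
intros Ha. rewrite Gamma_prod_half by auto.
replace (PI * a) with (2 * (a * (PI / 2))) by field. rewrite sin_2a.
replace (PI * (a / 2)) with (a * (PI / 2)) by field. ring.
Qed.

Lemma exp_chord t x : 0 <= t <= 1 -> exp (t * x) <= 1 - t + t * exp x.
Proof.
intros Ht.
(* tangent line at [t * x], evaluated at [0] and at [x] *)
assert (H1 := exp_ineq1_le (- (t * x))). assert (H2 := exp_ineq1_le (x - t * x)).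
assert (E1 : exp x = exp (t * x) * exp (x - t * x)) by (rewrite <- exp_plus; f_equal; ring).
assert (E2 : 1 = exp (t * x) * exp (- (t * x))) by (rewrite <- exp_plus, <- exp_0; f_equal; ring).
assert (H0 := exp_pos (t * x)).
assert (1 >= exp (t * x) * (1 - t * x)) by nra.
assert (exp x >= exp (t * x) * (1 + (x - t * x))) by nra.
nra.
Qed.

Lemma Gamma_1_plus_bounds h : 0 < h <= / 2 ->
  1 + 2 * h * (1 - Gamma (/ 2)) <= Gamma (1 + h) <= 1.
Proof.
intros Hh.
assert (G1 := pint_Gamma 1 Rlt_0_1). rewrite Gamma_1 in G1.
assert (Gh := pint_Gamma (1 + h) ltac:(lra)).
assert (G2 := pint_Gamma (/ 2) ltac:(lra)).
assert (G3 := pint_Gamma 2 ltac:(lra)).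
assert (E2 : Gamma 2 = 1).
{ replace 2 with (1 + 1) by ring. rewrite Gamma_succ, Gamma_1; lra. }
rewrite E2 in G3.
assert (C := poscont_Gamma_integrand).
split.
- apply (pint_le (fun s => (1 + 2 * h) * Gamma_integrand 1 s - 2 * h * Gamma_integrand (/ 2) s)
    (Gamma_integrand (1 + h))); auto.
  + apply (poscont_plus _ (fun s => - (2 * h * Gamma_integrand (/ 2) s))).
    now apply poscont_scal. intros x Hx. apply (continuous_opp (V := R_NormedModule)).
    now apply (poscont_scal (2 * h) (Gamma_integrand (/ 2))).
  + intros s Hs. unfold Gamma_integrand.
    replace (/ 2 - 1) with (- / 2) by field. replace (1 + h - 1) with h by ring.
    rewrite Rminus_diag, Rpower_O by auto.
    assert (P := exp_pos (- s)).
    apply Rle_trans with ((1 + 2 * h - 2 * h * Rpower s (- / 2)) * exp (- s)); [right; ring|].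
    apply Rmult_le_compat_r; [lra|]. unfold Rpower.
    assert (I1 := exp_ineq1_le (h * ln s)). assert (I2 := exp_ineq1_le (- / 2 * ln s)).
    nra.
  + apply pint_eq with ((1 + 2 * h) * 1 - 2 * h * Gamma (/ 2)). ring.
    apply pint_minus; now apply pint_scal.
- apply (pint_le (Gamma_integrand (1 + h))
    (fun s => (1 - h) * Gamma_integrand 1 s + h * Gamma_integrand 2 s)); auto.
  + apply poscont_plus; now apply poscont_scal.
  + intros s Hs. unfold Gamma_integrand.
    replace (2 - 1) with 1 by ring. replace (1 + h - 1) with h by ring.
    rewrite Rminus_diag, Rpower_O, Rpower_1 by auto.
    assert (P := exp_pos (- s)).
    apply Rle_trans with ((1 - h + h * s) * exp (- s)); [|right; ring].
    apply Rmult_le_compat_r; [lra|]. unfold Rpower.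
    assert (I1 := exp_chord h (ln s) ltac:(lra)). rewrite exp_ln in I1 by auto. lra.
  + apply pint_eq with ((1 - h) * 1 + h * 1). ring.
    apply pint_plus; now apply pint_scal.
Qed.

Lemma Gamma_1_minus_bounds h : 0 < h <= / 2 ->
  1 <= Gamma (1 - h) <= 1 + 2 * h * (Gamma (/ 2) - 1).
Proof.
intros Hh.
assert (G1 := pint_Gamma 1 Rlt_0_1). rewrite Gamma_1 in G1.
assert (Gh := pint_Gamma (1 - h) ltac:(lra)).
assert (G2 := pint_Gamma (/ 2) ltac:(lra)).
assert (G3 := pint_Gamma 2 ltac:(lra)).
assert (E2 : Gamma 2 = 1).
{ replace 2 with (1 + 1) by ring. rewrite Gamma_succ, Gamma_1; lra. }
rewrite E2 in G3.
assert (C := poscont_Gamma_integrand).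
split.
- apply (pint_le (fun s => (1 + h) * Gamma_integrand 1 s - h * Gamma_integrand 2 s)
    (Gamma_integrand (1 - h))); auto.
  + apply (poscont_plus _ (fun s => - (h * Gamma_integrand 2 s))).
    now apply poscont_scal. intros x Hx. apply (continuous_opp (V := R_NormedModule)).
    now apply (poscont_scal h (Gamma_integrand 2)).
  + intros s Hs. unfold Gamma_integrand.
    replace (2 - 1) with 1 by ring. replace (1 - h - 1) with (- h) by ring.
    rewrite Rminus_diag, Rpower_O, Rpower_1 by auto.
    assert (P := exp_pos (- s)).
    apply Rle_trans with ((1 + h - h * s) * exp (- s)); [right; ring|].
    apply Rmult_le_compat_r; [lra|]. unfold Rpower.
    assert (I1 := exp_ineq1_le (- h * ln s)). assert (I2 := exp_ineq1_le (ln s)).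
    rewrite exp_ln in I2 by auto. nra.
  + apply pint_eq with ((1 + h) * 1 - h * 1). ring.
    apply pint_minus; now apply pint_scal.
- apply (pint_le (Gamma_integrand (1 - h))
    (fun s => (1 - 2 * h) * Gamma_integrand 1 s + 2 * h * Gamma_integrand (/ 2) s)); auto.
  + apply poscont_plus; now apply poscont_scal.
  + intros s Hs. unfold Gamma_integrand.
    replace (/ 2 - 1) with (- / 2) by field. replace (1 - h - 1) with (2 * h * (- / 2)) by field.
    rewrite Rminus_diag, Rpower_O by auto.
    assert (P := exp_pos (- s)).
    apply Rle_trans with ((1 - 2 * h + 2 * h * Rpower s (- / 2)) * exp (- s)); [|right; ring].
    apply Rmult_le_compat_r; [lra|]. unfold Rpower. rewrite Rmult_assoc.
    apply (exp_chord (2 * h) (- / 2 * ln s)). lra.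
  + apply pint_eq with ((1 - 2 * h) * 1 + 2 * h * Gamma (/ 2)). ring.
    apply pint_plus; now apply pint_scal.
Qed.

Lemma is_lim_seq_halving a : is_lim_seq (fun n => a / 2 * (/ 2) ^ n) 0.
Proof.
replace (Finite 0) with (Rbar_mult (a / 2) 0) by (simpl; f_equal; ring).
apply is_lim_seq_scal_l. apply is_lim_seq_geom. rewrite Rabs_pos_eq; lra.
Qed.

Lemma Gamma_reflection a : 0 < a < 1 -> Gamma a * Gamma (1 - a) * sin (PI * a) = PI.
Proof.
intros Ha. assert (HP := PI_RGT_0).
set (h n := a / 2 * (/ 2) ^ n).
assert (Hh : forall n, 0 < h n <= / 2).
{ intros n. unfold h. assert (0 < (/ 2) ^ n) by (apply pow_lt; lra).
  assert ((/ 2) ^ n <= 1).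
  { rewrite <- (pow1 n). apply pow_incr. lra. }
  nra. }
assert (Hlim : is_lim_seq h 0) by apply is_lim_seq_halving.
assert (E : forall n, Gamma (h n) * Gamma (1 - h n) * sin (PI * h n) =
  Gamma a * Gamma (1 - a) * sin (PI * a)).
{ induction n.
  - unfold h. rewrite pow_O, Rmult_1_r. now apply Gamma_sin_half.
  - rewrite <- IHn. specialize (Hh n).
    replace (h (S n)) with (h n / 2) by (unfold h; simpl; field).
    apply Gamma_sin_half. lra. }
assert (L : forall c, is_lim_seq (fun n => 1 + 2 * h n * c) 1).
{ intros c. replace (Finite 1) with (Finite (1 + 2 * 0 * c)) by (f_equal; ring).
  apply (is_lim_seq_continuous (fun x => 1 + 2 * x * c) h 0); auto.
  apply ex_derive_continuity_pt. now auto_derive. }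
assert (L1 : is_lim_seq (fun n => Gamma (1 + h n)) 1).
{ apply (is_lim_seq_le_le (fun n => 1 + 2 * h n * (1 - Gamma (/ 2))) _ (fun n => 1)); auto.
  intros n. now apply Gamma_1_plus_bounds. apply is_lim_seq_const. }
assert (L2 : is_lim_seq (fun n => Gamma (1 - h n)) 1).
{ apply (is_lim_seq_le_le (fun n => 1) _ (fun n => 1 + 2 * h n * (Gamma (/ 2) - 1))); auto.
  intros n. now apply Gamma_1_minus_bounds. apply is_lim_seq_const. }
assert (L3 : is_lim_seq (fun n => sin (PI * h n) / (PI * h n)) 1).
{ apply (is_lim_comp_seq (fun x => sin x / x) (fun n => PI * h n) 0). apply is_lim_sinc_0.
  - exists 0%nat. intros n _. intros H. injection H as H. specialize (Hh n). nra.
  - replace (Finite 0) with (Rbar_mult PI 0) by (simpl; f_equal; ring).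
    now apply is_lim_seq_scal_l. }
assert (L4 := is_lim_seq_mult' _ _ _ _ (is_lim_seq_mult' _ _ _ _ L1 L2) L3).
assert (L5 := is_lim_seq_scal_l _ PI _ L4).
apply is_lim_seq_ext with (v := fun _ => Gamma a * Gamma (1 - a) * sin (PI * a)) in L5.
- apply is_lim_seq_unique in L5. rewrite Lim_seq_const in L5. injection L5 as ->. ring.
- intros n. specialize (Hh n). rewrite <- (E n), (Rplus_comm 1), Gamma_succ by lra. field. lra.
Qed.

Lemma Gamma_half : Gamma (/ 2) = sqrt PI.
Proof.
assert (H := Gamma_reflection (/ 2) ltac:(lra)).
replace (1 - / 2) with (/ 2) in H by field.
fold (Rdiv PI 2) in H. rewrite sin_PI2, Rmult_1_r in H.
rewrite <- H. symmetry. apply sqrt_square. left. apply Gamma_pos. lra.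
Qed.

Lemma poch_Gamma x n m : 0 < x + INR n ->
  poch x (m + n) / Gamma (x + INR (m + n)) = poch x n / Gamma (x + INR n).
Proof.
intros H. induction m; auto.
rewrite <- IHm. change (S m + n)%nat with (S (m + n)). rewrite S_INR. simpl poch.
assert (Hm : 0 < x + INR (m + n)) by (rewrite plus_INR; assert (H0 := pos_INR m); lra).
replace (x + (INR (m + n) + 1)) with (x + INR (m + n) + 1) by ring.
rewrite Gamma_succ by auto. assert (HG := Gamma_pos _ Hm). field. lra.
Qed.

Lemma rgamma_poch x n : 0 < x + INR n -> rgamma x = poch x n / Gamma (x + INR n).
Proof.
intros H. unfold rgamma. set (k := Z.to_nat (up (- x))).
assert (Hk : 0 < x + INR k).
{ destruct (archimed (- x)) as [Hu _]. destruct (Z.le_gt_cases 0 (up (- x))) as [Hz|Hz].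
  - unfold k. rewrite INR_IZR_INZ, Z2Nat.id by auto. lra.
  - assert (IZR (up (- x)) <= 0) by (apply IZR_le; lia).
    assert (Hk0 := pos_INR k). lra. }
rewrite <- (poch_Gamma x k n Hk), <- (poch_Gamma x n k H). now rewrite Nat.add_comm.
Qed.

Lemma poch_S_l x n : poch x (S n) = x * poch (x + 1) n.
Proof.
induction n. simpl. ring.
change (poch x (S (S n))) with (poch x (S n) * (x + INR (S n))).
rewrite IHn, S_INR. simpl. ring.
Qed.

Lemma rgamma_succ x : rgamma x = x * rgamma (x + 1).
Proof.
destruct (nfloor_ex (Rabs x) (Rabs_pos x)) as [n [_ Hn]].
assert (Hx := Rle_abs (- x)). rewrite Rabs_Ropp in Hx.
rewrite (rgamma_poch x (S n)), (rgamma_poch (x + 1) n), poch_S_l, S_INR.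
- replace (x + (INR n + 1)) with (x + 1 + INR n) by ring. unfold Rdiv. ring.
- lra.
- rewrite S_INR. lra.
Qed.

Lemma rgamma_pos x : 0 < x -> rgamma x = / Gamma x.
Proof.
intros Hx. rewrite (rgamma_poch x 0); simpl INR; rewrite Rplus_0_r; auto. simpl.
unfold Rdiv. ring.
Qed.

Lemma rgamma_reflection a : 0 < a -> rgamma (1 - a) = Gamma a * sin (PI * a) / PI.
Proof.
intros Ha. assert (HP := PI_RGT_0).
assert (S : forall b, 0 < b -> rgamma (1 - b) = Gamma b * sin (PI * b) / PI ->
  rgamma (1 - (b + 1)) = Gamma (b + 1) * sin (PI * (b + 1)) / PI).
{ intros b Hb E. rewrite rgamma_succ. replace (1 - (b + 1) + 1) with (1 - b) by ring.
  rewrite E, Gamma_succ by auto. rewrite Rmult_plus_distr_l, Rmult_1_r, neg_sin. field. lra. }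
assert (B : forall b, 0 < b < 1 -> rgamma (1 - b) = Gamma b * sin (PI * b) / PI).
{ intros b Hb. rewrite rgamma_pos by lra.
  assert (H := Gamma_reflection b Hb). assert (HG := Gamma_pos (1 - b) ltac:(lra)).
  apply Rmult_eq_reg_r with (Gamma (1 - b) * PI); [|nra].
  field_simplify; lra. }
assert (B1 : rgamma (1 - 1) = Gamma 1 * sin (PI * 1) / PI).
{ rewrite Rmult_1_r, sin_PI, rgamma_succ. field. lra. }
assert (I : forall n a, INR n < a <= INR n + 1 -> rgamma (1 - a) = Gamma a * sin (PI * a) / PI).
{ induction n; intros b Hb.
  - simpl in Hb. destruct (Req_dec b 1) as [->|Hb1]; auto. apply B. lra.
  - rewrite S_INR in Hb. assert (H0 := pos_INR n).
    replace b with (b - 1 + 1) by ring. apply S. lra. apply IHn. lra. }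
destruct (nfloor1_ex a Ha) as [n Hn]. now apply (I n).
Qed.

(** * Termwise integration of exponential series *)

Lemma fact_inv_pos k : 0 < / INR (fact k).
Proof. apply Rinv_0_lt_compat, INR_fact_lt_0. Qed.

Lemma is_series_exp x : is_series (fun k => x ^ k / INR (fact k)) (exp x).
Proof.
apply is_series_ext with (2 := is_exp_Reals x). intros k.
rewrite pow_n_pow. reflexivity.
Qed.

Lemma sum_n_le_series (a : nat -> R) l n :
  is_series a l -> (forall k, 0 <= a k) -> sum_n a n <= l.
Proof.
intros Hl Ha. apply (is_lim_seq_incr_compare (sum_n a) l Hl).
intros m. rewrite sum_Sn. unfold plus; simpl. specialize (Ha (S m)). lra.
Qed.

Lemma series_tail_le (a b : nat -> R) s t n :
  is_series a s -> is_series b t -> (forall k, Rabs (a k) <= b k) ->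
  Rabs (s - sum_n a n) <= t - sum_n b n.
Proof.
intros Hs Ht Hab.
assert (H : forall k, - b k <= a k <= b k) by (intros; now apply Rabs_le_between).
assert (H1 : sum_n (fun k => b k - a k) n <= t - s).
{ apply sum_n_le_series. exact (is_series_minus b a t s Ht Hs).
  intros k. specialize (H k). lra. }
assert (H2 : sum_n (fun k => b k + a k) n <= t + s).
{ apply sum_n_le_series. exact (is_series_plus b a t s Ht Hs).
  intros k. specialize (H k). lra. }
rewrite !sum_n_Reals in *. rewrite minus_sum in H1. rewrite sum_plus in H2.
apply Rabs_le_between. lra.
Qed.

Lemma Tannery (a : nat -> nat -> R) (a0 b : nat -> R) :
  (forall n k, Rabs (a n k) <= b k) -> ex_series b ->
  (forall k, is_lim_seq (fun n => a n k) (a0 k)) ->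
  ex_series a0 /\ is_lim_seq (fun n => Series (a n)) (Series a0).
Proof.
intros Hdom [t Ht] Hlim.
assert (Hdom0 : forall k, Rabs (a0 k) <= b k).
{ intros k. assert (H := is_lim_seq_abs _ _ (Hlim k)).
  assert (H1 := is_lim_seq_le _ (fun _ => b k) _ (b k) (fun n => Hdom n k) H
    (is_lim_seq_const (b k))). exact H1. }
assert (X0 : ex_series a0) by (apply (ex_series_le a0 b); [exact Hdom0 | now exists t]).
assert (X : forall n, ex_series (a n))
  by (intros n; apply (ex_series_le (a n) b); [exact (Hdom n) | now exists t]).
split; auto. apply is_lim_seq_spec. intros e. assert (He := cond_pos e).
destruct (Ht (ball t (e / 4)) (locally_ball t (mkposreal (e / 4) ltac:(lra)))) as [N HN].
specialize (HN N (Nat.le_refl N)). change (Rabs (sum_n b N - t) < e / 4) in HN.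
assert (S : is_lim_seq (fun n => sum_n (a n) N) (sum_n a0 N)).
{ clear HN. induction N.
  - rewrite sum_O. apply is_lim_seq_ext with (2 := Hlim O). intros n. now rewrite sum_O.
  - rewrite sum_Sn. apply is_lim_seq_ext with (fun n => sum_n (a n) N + a n (S N)).
    intros n. now rewrite sum_Sn. now apply is_lim_seq_plus'. }
apply is_lim_seq_spec in S. destruct (S (mkposreal (e / 4) ltac:(lra))) as [M HM].
exists M. intros n Hn. specialize (HM n Hn). simpl in HM.
assert (T0 := series_tail_le a0 b _ t N (Series_correct _ X0) Ht Hdom0).
assert (T1 := series_tail_le (a n) b _ t N (Series_correct _ (X n)) Ht (Hdom n)).
apply Rabs_def2 in HM. apply Rabs_def2 in HN.
apply Rabs_le_between in T0. apply Rabs_le_between in T1.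
apply Rabs_def1; lra.
Qed.

Lemma poscont_bounded f a b : poscont f -> 0 < a <= b ->
  exists K, 0 < K /\ forall x, a <= x <= b -> Rabs (f x) <= K.
Proof.
intros Hf Hab.
destruct (continuity_ab_maj (fun x => Rabs (f x)) a b ltac:(lra)) as [m [Hm _]].
- intros c Hc. apply continuity_pt_filterlim.
  apply (continuous_comp f Rabs). apply Hf; lra. apply (continuous_Rabs (f c)).
- exists (Rabs (f m) + 1). split. assert (H := Rabs_pos (f m)). lra.
  intros x Hx. specialize (Hm x Hx). lra.
Qed.

Lemma pint_exp_series (w v s g : R -> R) (c I : nat -> R) L :
  poscont w -> poscont v -> poscont s -> poscont g -> pint g L ->
  (forall k, Rabs (c k) <= 1) ->
  (forall r, 0 < r -> Rabs (w r) * exp (Rabs (v r)) <= g r) ->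
  (forall r, 0 < r -> is_series (fun k => c k * (v r ^ k / INR (fact k))) (s r)) ->
  (forall k, pint (fun r => w r * v r ^ k) (I k)) ->
  exists l, pint (fun r => w r * s r) l /\ is_series (fun k => c k * (I k / INR (fact k))) l.
Proof.
intros Hw Hv Hs Hg HL Hc Hdom Hser HI.
set (T r k := c k * (v r ^ k / INR (fact k))).
assert (HT : forall V r k, Rabs (v r) <= V -> Rabs (T r k) <= V ^ k / INR (fact k)).
{ intros V r k HV. unfold T, Rdiv. rewrite !Rabs_mult, (Rabs_pos_eq (/ _)).
  2:{ left. apply fact_inv_pos. }
  assert (H0 := Rabs_pos (v r ^ k)). assert (H1 := fact_inv_pos k).
  rewrite <- Rmult_assoc. apply Rmult_le_compat_r. lra.
  apply Rle_trans with (1 * Rabs (v r ^ k)). apply Rmult_le_compat_r; auto.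
  rewrite Rmult_1_l, <- RPow_abs. apply pow_incr. split; auto. apply Rabs_pos. }
assert (CT : forall n, poscont (fun r => sum_n (T r) n)).
{ assert (CP : forall k, poscont (fun r => T r k)).
  { intros k. apply poscont_scal.
    assert (CV : poscont (fun r => v r ^ k)).
    { induction k; simpl. apply poscont_const. now apply (poscont_mult v). }
    apply (poscont_mult (fun r => v r ^ k)); auto. apply poscont_const. }
  induction n.
  - intros x Hx. apply (continuous_ext (fun r => T r O)). intros; now rewrite sum_O. now apply CP.
  - intros x Hx. apply (continuous_ext (fun r => sum_n (T r) n + T r (S n))).
    intros; now rewrite sum_Sn. now apply (poscont_plus (fun r => sum_n (T r) n)). }
destruct (pint_lim (fun n r => w r * sum_n (T r) n) (fun r => w r * s r) g
  (sum_n (fun k => c k * (I k / INR (fact k)))) L) as [l [Hl1 Hl2]]; auto.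
- intros n. now apply poscont_mult.
- now apply poscont_mult.
- intros n r Hr. apply Rle_trans with (2 := Hdom r Hr). rewrite Rabs_mult.
  apply Rmult_le_compat_l. apply Rabs_pos.
  apply Rle_trans with (sum_n (fun k => Rabs (v r) ^ k / INR (fact k)) n).
  + rewrite !sum_n_Reals. apply Rle_trans with (1 := Rsum_abs _ _).
    apply sum_Rle. intros k _. apply HT. lra.
  + apply sum_n_le_series. apply is_series_exp.
    intros k. apply Rmult_le_pos. apply pow_le, Rabs_pos. left; apply fact_inv_pos.
- intros a b eps Hab He.
  destruct (poscont_bounded w a b Hw ltac:(lra)) as [W [HW0 HW]].
  destruct (poscont_bounded v a b Hv ltac:(lra)) as [V [HV0 HV]].
  assert (He' : 0 < eps / W) by (apply Rdiv_lt_0_compat; lra).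
  destruct (is_series_exp V (ball (exp V) (eps / W))
    (locally_ball (exp V) (mkposreal _ He'))) as [N HN].
  exists N. intros n Hn r Hr. specialize (HN n Hn).
  change (Rabs (sum_n (fun k => V ^ k / INR (fact k)) n - exp V) < eps / W) in HN.
  assert (HT1 := series_tail_le (T r) (fun k => V ^ k / INR (fact k)) (s r) (exp V) n
    (Hser r ltac:(lra)) (is_series_exp V) (fun k => HT V r k (HV r Hr))).
  rewrite Rabs_minus_sym in HT1.
  apply Rabs_def2 in HN.
  rewrite <- Rmult_minus_distr_l, Rabs_mult.
  assert (H1 := HW r Hr). assert (H2 := Rabs_pos (sum_n (T r) n - s r)).
  apply Rle_lt_trans with (W * Rabs (sum_n (T r) n - s r)).
  now apply Rmult_le_compat_r.
  replace eps with (W * (eps / W)) by (field; lra). apply Rmult_lt_compat_l; lra.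
- intros n. induction n.
  + rewrite sum_O. apply pint_eq with (c O / INR (fact 0) * I O). unfold Rdiv; ring.
    generalize (pint_scal _ (c O / INR (fact 0)) _ (HI O)). apply pint_ext.
    intros x Hx. rewrite sum_O. unfold T, Rdiv. ring.
  + rewrite sum_Sn.
    apply pint_eq with (sum_n (fun k => c k * (I k / INR (fact k))) n +
      c (S n) / INR (fact (S n)) * I (S n)).
    unfold plus, Rdiv; simpl; ring.
    generalize (pint_plus _ _ _ _ IHn (pint_scal _ (c (S n) / INR (fact (S n))) _ (HI (S n)))).
    apply pint_ext.
    intros x Hx. rewrite sum_Sn. unfold T, Rdiv, plus; simpl. ring.
- exists l. split; auto.
Qed.

Lemma is_derive_n_exp_sin th b k t :
  is_derive_n (fun y => exp (y * cos th) * sin (b + y * sin th)) k t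
    (exp (t * cos th) * sin (b + INR k * th + t * sin th)).
Proof.
revert t. induction k; intros t.
- simpl. f_equal. f_equal. ring.
- rewrite S_INR. simpl is_derive_n.
  apply is_derive_ext with (fun y => exp (y * cos th) * sin (b + INR k * th + y * sin th)).
  + intros y. symmetry. apply is_derive_n_unique. apply IHk.
  + auto_derive; auto.
    replace (b + (INR k + 1) * th + t * sin th) with (th + (b + INR k * th + t * sin th)) by ring.
    rewrite (sin_plus th). ring.
Qed.

Lemma is_series_sin_shift th b y : 0 < y ->
  is_series (fun k => sin (b + INR k * th) * (y ^ k / INR (fact k)))
    (exp (y * cos th) * sin (b + y * sin th)).
Proof.
intros Hy. set (f y := exp (y * cos th) * sin (b + y * sin th)).
assert (HP : is_lim_seq (fun n => exp y * (y ^ S n / INR (fact (S n)))) 0).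
{ replace (Finite 0) with (Rbar_mult (exp y) 0) by (simpl; f_equal; ring).
  apply is_lim_seq_scal_l. apply (is_lim_seq_incr_1 (fun n => y ^ n / INR (fact n))).
  apply ex_series_lim_0. exists (exp y). apply is_series_exp. }
change (is_lim_seq (sum_n (fun k => sin (b + INR k * th) * (y ^ k / INR (fact k)))) (f y)).
apply is_lim_seq_spec. intros e. apply is_lim_seq_spec in HP.
assert (D : forall k t, Derive_n f k t = exp (t * cos th) * sin (b + INR k * th + t * sin th))
  by (intros; apply is_derive_n_unique; apply is_derive_n_exp_sin).
destruct (HP e) as [N HN]. exists N. intros n Hn. specialize (HN n Hn).
rewrite Rminus_0_r in HN.
destruct (Taylor_Lagrange f n 0 y Hy) as [z [Hz E]].
{ intros t _ k _. destruct k. exact I. eexists. apply (is_derive_n_exp_sin th b (S k)). }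
rewrite sum_n_Reals.
match goal with |- Rabs (?A - ?B) < _ =>
  replace (A - B) with (- (y ^ S n / INR (fact (S n)) * Derive_n f (S n) z)) end.
2:{ fold (f y). rewrite E, Rminus_0_r.
  match goal with |- _ = ?A - (?B + _) => replace B with A end. ring.
  apply sum_eq. intros k _. rewrite D.
  rewrite !Rmult_0_l, exp_0, Rplus_0_r. ring. }
rewrite D.
apply Rle_lt_trans with (2 := HN). rewrite Rabs_Ropp, (Rmult_comm (exp y)), !Rabs_mult.
apply Rmult_le_compat_l. apply Rabs_pos. rewrite !(Rabs_pos_eq (exp _)) by (left; apply exp_pos).
assert (S1 := SIN_bound (b + INR (S n) * th + z * sin th)).
assert (S2 : Rabs (sin (b + INR (S n) * th + z * sin th)) <= 1) by (apply Rabs_le; lra).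
assert (S3 : exp (z * cos th) <= exp y).
{ apply exp_le_compat. assert (C := COS_bound th). nra. }
assert (P1 := exp_pos (z * cos th)). assert (P2 := Rabs_pos (sin (b + INR (S n) * th + z * sin th))).
nra.
Qed.

(** * The M-Wright function *)

Lemma Rpower_succ_nat z p k : Rpower z (p * (INR k + 1)) = Rpower z p * Rpower z p ^ k.
Proof.
rewrite <- (Rpower_pow k) by apply Rpower_pos.
rewrite Rpower_mult, <- Rpower_plus. f_equal. ring.
Qed.

Lemma Rpower_le_affine nu Y eta : 0 < nu < 1 -> 0 < Y -> 0 < eta ->
  exists C, forall r, 0 < r -> Y * Rpower r nu <= C + eta * r.
Proof.
intros Hnu HY Heta.
set (M := Rpower (eta / Y) (/ (1 - nu))).
assert (HM : 0 < M) by apply Rpower_pos.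
assert (EM : Y * Rpower M (- nu) * M = eta).
{ rewrite Rmult_assoc, Rmult_comm, (Rmult_comm (Rpower M _)).
  replace (M * Rpower M (- nu)) with (Rpower M (1 - nu)).
  - unfold M. rewrite Rpower_mult, Rinv_l, Rpower_1 by (try apply Rdiv_lt_0_compat; lra).
    field. lra.
  - unfold Rminus. now rewrite Rpower_plus, Rpower_1. }
exists (Y * Rpower M (- nu)). intros r Hr.
assert (HMr : 0 < M * r) by now apply Rmult_lt_0_compat.
assert (H := exp_chord nu (ln (M * r)) ltac:(lra)). rewrite exp_ln in H by auto.
assert (E : Rpower r nu = Rpower M (- nu) * Rpower (M * r) nu).
{ rewrite <- Rpower_mult_distr, Rpower_Ropp by auto. assert (P := Rpower_pos M nu). field. lra. }
rewrite E. fold (Rpower (M * r) nu) in H.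
assert (P := Rpower_pos M (- nu)).
assert (HYM : 0 < Y * Rpower M (- nu)) by now apply Rmult_lt_0_compat.
rewrite <- EM, <- Rmult_assoc.
replace (Y * Rpower M (- nu) + Y * Rpower M (- nu) * M * r)
  with (Y * Rpower M (- nu) * (1 + M * r)) by ring.
apply Rmult_le_compat_l; nra.
Qed.

Definition ray_kernel (z phi r : R) : R := exp (- (r * z * cos phi)) * cos (r * z * sin phi).

Lemma ray_kernel_le z phi r : Rabs (ray_kernel z phi r) <= exp (- (r * z * cos phi)).
Proof.
unfold ray_kernel. rewrite Rabs_mult, Rabs_pos_eq by (left; apply exp_pos).
assert (S := COS_bound (r * z * sin phi)).
assert (Rabs (cos (r * z * sin phi)) <= 1) by (apply Rabs_le; lra).
assert (P := exp_pos (- (r * z * cos phi))). nra.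
Qed.

Lemma pint_ray_kernel_series nu X z phi (c : nat -> R) (s : R -> R) :
  0 < nu < 1 -> 0 < X -> 0 < z -> 0 <= phi < PI / 2 -> poscont s ->
  (forall k, Rabs (c k) <= 1) ->
  (forall r, 0 < r ->
     is_series (fun k => c k * ((X * Rpower r nu) ^ k / INR (fact k))) (s r)) ->
  exists l,
    pint (fun r => Rpower r (nu - 1) * ray_kernel z phi r * s r) l /\
    is_series (fun k => c k * (X ^ k * (Gamma (nu * (INR k + 1)) *
      Rpower z (- (nu * (INR k + 1))) * cos (nu * (INR k + 1) * phi)) / INR (fact k))) l.
Proof.
intros Hnu HX Hz Hphi Hs Hc Hser. assert (HP := PI_RGT_0).
assert (Hcos : 0 < cos phi) by (apply cos_gt_0; lra).
set (eta := z * cos phi / 2).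
assert (Heta : 0 < eta).
{ unfold eta. assert (0 < z * cos phi) by now apply Rmult_lt_0_compat. lra. }
destruct (Rpower_le_affine nu X eta Hnu HX Heta) as [C HC].
assert (HG := pint_scal _ (exp C) _ (pint_Gamma_kernel nu eta 0 ltac:(lra) Heta ltac:(lra))).
refine (pint_exp_series _ (fun r => X * Rpower r nu) s _ c _ _ _ _ Hs _ HG Hc _ Hser _).
- apply poscont_ex_derive. intros x Hx. unfold ray_kernel, Rpower. now auto_derive.
- apply poscont_scal, poscont_Rpower.
- apply poscont_ex_derive. intros x Hx. unfold Rpower. now auto_derive.
- intros r Hr. assert (P := Rpower_pos r nu). assert (P1 := Rpower_pos r (nu - 1)).
  rewrite cos_0, sin_0, !Rmult_0_r, cos_0, !Rmult_1_r, Rabs_mult.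
  rewrite (Rabs_pos_eq (Rpower _ _)), (Rabs_pos_eq (X * _)) by nra.
  rewrite (Rmult_comm (exp C)), !Rmult_assoc. apply Rmult_le_compat_l. lra.
  rewrite <- exp_plus. assert (K := ray_kernel_le z phi r).
  apply Rle_trans with (exp (- (r * z * cos phi)) * exp (X * Rpower r nu)).
  apply Rmult_le_compat_r; auto. left; apply exp_pos.
  rewrite <- exp_plus. apply exp_le_compat. specialize (HC r Hr). unfold eta in *.
  replace (r * z * cos phi) with (2 * (z * cos phi / 2 * r)) by field. lra.
- intros k. set (a := nu * (INR k + 1)).
  assert (Ha : 0 < a) by (assert (H := pos_INR k); unfold a; apply Rmult_lt_0_compat; lra).
  generalize (pint_scal _ (X ^ k) _ (pint_Gamma_kernel a z phi Ha Hz Hphi)). apply pint_ext.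
  intros r Hr. unfold ray_kernel. rewrite Rpow_mult_distr.
  replace (Rpower r (a - 1)) with (Rpower r (nu - 1) * Rpower r nu ^ k). ring.
  replace (a - 1) with (a + - (1)) by ring. unfold a.
  rewrite Rpower_plus, Rpower_succ_nat. replace (nu - 1) with (nu + - (1)) by ring.
  rewrite Rpower_plus. ring.
Qed.

Lemma ex_series_Gamma nu Y : 0 < nu < 1 -> 0 < Y ->
  ex_series (fun k => Gamma (nu * (INR k + 1)) * Y ^ k / INR (fact k)).
Proof.
intros Hnu HY. assert (HP := PI_RGT_0).
destruct (pint_ray_kernel_series nu Y 1 0 (fun _ => 1) (fun r => exp (Y * Rpower r nu)))
  as [l [_ Hl]]; try lra.
- apply poscont_ex_derive. intros x Hx. unfold Rpower. now auto_derive.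
- intros _. rewrite Rabs_R1. lra.
- intros r Hr. generalize (is_series_exp (Y * Rpower r nu)). apply is_series_ext.
  intros k. now rewrite Rmult_1_l.
- exists l. revert Hl. apply is_series_ext. intros k.
  rewrite Rmult_0_r, cos_0. unfold Rpower. rewrite ln_1, Rmult_0_r, exp_0.
  match goal with |- ?a = ?b => change (@eq R a b) end. unfold Rdiv. ring.
Qed.

Definition wright_coef (sg : R) (k : nat) : R :=
  (-1) ^ k / INR (fact k) * rgamma (1 - sg * (INR k + 1)).

Definition wright (sg y : R) : R := PSeries (wright_coef sg) y.

Lemma wright_arg_pos sg k : 0 < sg -> 0 < sg * (INR k + 1).
Proof. intros H. assert (H0 := pos_INR k). apply Rmult_lt_0_compat; lra. Qed.

Lemma ex_series_wright sg y : 0 < sg < 1 -> ex_series (fun k => Rabs (wright_coef sg k * y ^ k)).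
Proof.
intros Hsg. assert (HP := PI_RGT_0). assert (HP1 := PI2_1).
assert (HY : 0 < Rabs y + 1) by (assert (H := Rabs_pos y); lra).
apply (ex_series_le (K := R_AbsRing) (V := R_CompleteNormedModule) _
  (fun k => Gamma (sg * (INR k + 1)) * (Rabs y + 1) ^ k / INR (fact k))).
2:{ apply ex_series_Gamma; auto. }
intros k. change (Rabs (Rabs (wright_coef sg k * y ^ k)) <=
  Gamma (sg * (INR k + 1)) * (Rabs y + 1) ^ k / INR (fact k)).
rewrite Rabs_Rabsolu. unfold wright_coef.
assert (Ha := wright_arg_pos sg k (proj1 Hsg)). set (a := sg * (INR k + 1)) in *.
rewrite rgamma_reflection by auto.
assert (G := Gamma_pos a Ha). assert (F := fact_inv_pos k).
unfold Rdiv. rewrite !Rabs_mult, (Rabs_pos_eq (/ INR (fact k))), (Rabs_pos_eq (Gamma a)) by lra.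
rewrite pow_1_abs, Rmult_1_l.
assert (S := SIN_bound (PI * a)).
assert (S1 : Rabs (sin (PI * a)) <= 1) by (apply Rabs_le; lra).
assert (S2 := Rabs_pos (sin (PI * a))).
assert (S3 : 0 < / PI <= 1).
{ split. now apply Rinv_0_lt_compat. rewrite <- Rinv_1. apply Rinv_le_contravar; lra. }
rewrite (Rabs_pos_eq (/ PI)) by lra.
assert (Y1 : Rabs (y ^ k) <= (Rabs y + 1) ^ k).
{ rewrite <- RPow_abs. apply pow_incr. assert (H := Rabs_pos y). lra. }
assert (Y0 := Rabs_pos (y ^ k)).
replace (/ INR (fact k) * (Gamma a * Rabs (sin (PI * a)) * / PI) * Rabs (y ^ k))
  with (Gamma a * / INR (fact k) * (Rabs (sin (PI * a)) * / PI * Rabs (y ^ k))) by ring.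
replace (Gamma a * (Rabs y + 1) ^ k * / INR (fact k))
  with (Gamma a * / INR (fact k) * (1 * 1 * (Rabs y + 1) ^ k)) by ring.
apply Rmult_le_compat_l. apply Rmult_le_pos; lra.
apply Rmult_le_compat; auto. apply Rmult_le_pos; lra. apply Rmult_le_compat; lra.
Qed.

Lemma CV_radius_wright sg : 0 < sg < 1 -> CV_radius (wright_coef sg) = p_infty.
Proof.
intros Hsg.
assert (H : forall x, Rbar_le (Rabs x) (CV_radius (wright_coef sg))).
{ intros x. apply Rbar_not_lt_le. intros Hx.
  apply (CV_disk_outside (wright_coef sg) x Hx).
  apply ex_series_lim_0. apply ex_series_Rabs. now apply ex_series_wright. }
destruct (CV_radius (wright_coef sg)) as [r| |]; auto.
- specialize (H (Rabs r + 1)). simpl in H.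
  assert (H1 := Rle_abs r). rewrite Rabs_pos_eq in H; lra || (assert (H2 := Rabs_pos r); lra).
- now specialize (H 0).
Qed.

Lemma continuity_pt_wright sg y : 0 < sg < 1 -> continuity_pt (wright sg) y.
Proof. intros Hsg. apply PSeries_continuity. now rewrite CV_radius_wright. Qed.

Lemma u_wright mu lambda x t : 0 < lambda -> 0 < t ->
  u mu lambda x t =
  / (2 * lambda * Rpower t (mu / 2)) *
    wright (mu / 2) (Rabs x / lambda * Rpower t (- (mu / 2))).
Proof.
intros Hl Ht. unfold u. f_equal. unfold wright, PSeries. apply Series_ext. intros k.
unfold wright_coef. replace (- mu * INR k / 2 + 1 - mu / 2) with (1 - mu / 2 * (INR k + 1)) by field.
rewrite Rpower_Ropp. assert (P := Rpower_pos t (mu / 2)).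
replace (- Rabs x / (lambda * Rpower t (mu / 2)))
  with ((-1) * (Rabs x / lambda * / Rpower t (mu / 2))) by (field; lra).
rewrite Rpow_mult_distr. unfold Rdiv. ring.
Qed.

(* [Rpower r (nu - 1) * stable_osc nu X r] is the imaginary part of i^nu r^(nu-1) exp(-X (i r)^nu). *)
Definition stable_osc (nu X r : R) : R :=
  exp (- (X * Rpower r nu * cos (PI * nu / 2))) *
  sin (PI * nu / 2 - X * Rpower r nu * sin (PI * nu / 2)).

Lemma poscont_stable_osc nu X : poscont (stable_osc nu X).
Proof. apply poscont_ex_derive. intros x Hx. unfold stable_osc, Rpower. now auto_derive. Qed.

Lemma sin_add_nat_PI x k : sin (x + INR k * PI) = (-1) ^ k * sin x.
Proof.
induction k.
- simpl. replace (x + 0 * PI) with x by ring. ring.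
- rewrite S_INR. replace (x + (INR k + 1) * PI) with (x + INR k * PI + PI) by ring.
  rewrite neg_sin, IHk. simpl. ring.
Qed.

Definition osc_coef (nu : R) (k : nat) : R := (-1) ^ k * sin (PI / 2 * (nu * (INR k + 1))).

Lemma osc_coef_le nu k : Rabs (osc_coef nu k) <= 1.
Proof.
unfold osc_coef. rewrite Rabs_mult, pow_1_abs, Rmult_1_l.
apply Rabs_le. assert (S := SIN_bound (PI / 2 * (nu * (INR k + 1)))). lra.
Qed.

Lemma is_series_stable_osc nu X r : 0 < X ->
  is_series (fun k => osc_coef nu k * ((X * Rpower r nu) ^ k / INR (fact k)))
    (stable_osc nu X r).
Proof.
intros HX. assert (P := Rpower_pos r nu).
assert (H := is_series_sin_shift (PI * nu / 2 + PI) (PI * nu / 2) (X * Rpower r nu)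
  ltac:(now apply Rmult_lt_0_compat)).
rewrite neg_cos, neg_sin in H. unfold stable_osc.
replace (- (X * Rpower r nu * cos (PI * nu / 2)))
  with (X * Rpower r nu * - cos (PI * nu / 2)) by ring.
replace (PI * nu / 2 - X * Rpower r nu * sin (PI * nu / 2))
  with (PI * nu / 2 + X * Rpower r nu * - sin (PI * nu / 2)) by ring.
revert H. apply is_series_ext. intros k. f_equal. unfold osc_coef.
rewrite <- sin_add_nat_PI. f_equal. field.
Qed.

Lemma stable_osc_le nu X r : 
  Rabs (stable_osc nu X r) <= exp (- (X * Rpower r nu * cos (PI * nu / 2))).
Proof.
unfold stable_osc. rewrite Rabs_mult, Rabs_pos_eq by (left; apply exp_pos).
assert (S := SIN_bound (PI * nu / 2 - X * Rpower r nu * sin (PI * nu / 2))).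
assert (S1 : Rabs (sin (PI * nu / 2 - X * Rpower r nu * sin (PI * nu / 2))) <= 1)
  by (apply Rabs_le; lra).
assert (P := exp_pos (- (X * Rpower r nu * cos (PI * nu / 2)))). nra.
Qed.

(** * Integral representations *)

Lemma cos_stable_pos nu : 0 < nu < 1 -> 0 < cos (PI * nu / 2).
Proof. intros Hnu. assert (HP := PI_RGT_0). apply cos_gt_0; nra. Qed.

Lemma pint_stable_majorant nu X : 0 < nu < 1 -> 0 < X ->
  pint (fun r => Rpower r (nu - 1) * exp (- (X * Rpower r nu * cos (PI * nu / 2))))
    (/ (nu * (X * cos (PI * nu / 2)))).
Proof.
intros Hnu HX. assert (Hc := cos_stable_pos nu Hnu).
assert (Hd : 0 < X * cos (PI * nu / 2)) by now apply Rmult_lt_0_compat.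
assert (H := pint_subst_Rpower _ _ _ nu Hd (proj1 Hnu) (poscont_Gamma_integrand 1)
  (pint_Gamma 1 Rlt_0_1)).
rewrite Gamma_1 in H.
apply pint_eq with (/ (nu * (X * cos (PI * nu / 2))) * 1). ring.
generalize (pint_scal _ (/ (nu * (X * cos (PI * nu / 2)))) _ H). apply pint_ext.
intros r Hr. assert (P := Rpower_pos r nu). unfold Gamma_integrand.
rewrite Rminus_diag, Rpower_O by now apply Rmult_lt_0_compat.
replace (X * cos (PI * nu / 2) * Rpower r nu) with (X * Rpower r nu * cos (PI * nu / 2)) by ring.
field. lra.
Qed.

Lemma ray_kernel_diff_le z phi r : 0 <= phi <= PI / 2 -> 0 < r -> 0 < z ->
  Rabs (ray_kernel z phi r - cos (r * z)) <= 2 * (r * z) * cos phi.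
Proof.
intros Hphi Hr Hz. assert (HP := PI_RGT_0).
assert (Hc : 0 <= cos phi) by (apply cos_ge_0; lra).
assert (Hs : 0 <= sin phi) by (apply sin_ge_0; lra).
assert (E := sin2_cos2 phi). unfold Rsqr in E.
assert (Hs1 : 1 - sin phi <= cos phi) by nra.
assert (Hs2 := SIN_bound phi).
assert (Hrz : 0 < r * z) by now apply Rmult_lt_0_compat.
unfold ray_kernel. set (q := r * z) in *.
assert (Hexp := exp_ineq1_le (- (q * cos phi))).
assert (Hexp1 : exp (- (q * cos phi)) <= 1) by (rewrite <- exp_0; apply exp_le_compat; nra).
assert (Hcos : Rabs (cos (q * sin phi) - cos q) <= q * cos phi).
{ destruct (MVT_gen cos (q * sin phi) q (fun x => - sin x)) as [x [_ Hx]].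
  - intros x _. auto_derive; auto. ring.
  - intros x _. apply continuity_cos.
  - rewrite Rabs_minus_sym, Hx, Rabs_mult, Rabs_Ropp.
    assert (S := SIN_bound x). assert (Rabs (sin x) <= 1) by (apply Rabs_le; lra).
    replace (q - q * sin phi) with (q * (1 - sin phi)) by ring.
    assert (H0 := Rabs_pos (sin x)).
    assert (0 <= q * (1 - sin phi) <= q * cos phi) by nra.
    rewrite (Rabs_pos_eq (q * _)) by lra. nra. }
replace (exp (- (q * cos phi)) * cos (q * sin phi) - cos q)
  with ((exp (- (q * cos phi)) - 1) * cos (q * sin phi) + (cos (q * sin phi) - cos q)) by ring.
apply Rle_trans with (1 := Rabs_triang _ _). rewrite Rabs_mult.
assert (S := COS_bound (q * sin phi)).
assert (S1 : Rabs (cos (q * sin phi)) <= 1) by (apply Rabs_le; lra).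
assert (S2 := Rabs_pos (cos (q * sin phi))).
rewrite (Rabs_left1 (exp _ - 1)) by lra. nra.
Qed.

Lemma Rabs_cos_le x : Rabs (cos x) <= 1.
Proof. apply Rabs_le. assert (H := COS_bound x). lra. Qed.

(* Fourier cosine representation: the rays of argument [phi < PI / 2], on which the series can
   be integrated termwise, are rotated to the imaginary axis. *)
Lemma pint_cos_stable_osc nu X z : 0 < nu < 1 -> 0 < X -> 0 < z ->
  pint (fun r => Rpower r (nu - 1) * cos (r * z) * stable_osc nu X r)
    (PI / 2 * (Rpower z (- nu) * wright nu (X * Rpower z (- nu)))).
Proof.
intros Hnu HX Hz. assert (HP := PI_RGT_0).
assert (Hc := cos_stable_pos nu Hnu).
set (ph n := PI / 2 - / (INR n + 1)).
assert (Hph : forall n, 0 <= ph n < PI / 2 /\ 0 <= cos (ph n) <= / (INR n + 1))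
  by exact half_pi_seq_bounds.
set (a k := nu * (INR k + 1)).
set (term p k := osc_coef nu k * (X ^ k * (Gamma (a k) *
  Rpower z (- a k) * cos (a k * p)) / INR (fact k))).
set (f n r := Rpower r (nu - 1) * ray_kernel z (ph n) r * stable_osc nu X r).
assert (Hn : forall n, exists l, pint (f n) l /\ is_series (term (ph n)) l).
{ intros n. apply pint_ray_kernel_series; auto.
  - apply Hph. - apply poscont_stable_osc. - apply osc_coef_le.
  - intros r _. now apply is_series_stable_osc. }
assert (Hl : forall n, pint (f n) (Series (term (ph n)))).
{ intros n. destruct (Hn n) as [l [Hl1 Hl2]]. now rewrite (is_series_unique _ _ Hl2). }
assert (HM := pint_stable_majorant nu X Hnu HX).
assert (H0 : exists l0,
  pint (fun r => Rpower r (nu - 1) * cos (r * z) * stable_osc nu X r) l0 /\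
  is_lim_seq (fun n => Series (term (ph n))) l0).
{ refine (pint_lim f _ _ _ _ _ _ _ HM _ _ Hl).
- intros n. apply poscont_mult; [|apply poscont_stable_osc].
  apply poscont_ex_derive. intros x Hx. unfold ray_kernel, Rpower. now auto_derive.
- apply poscont_mult; [|apply poscont_stable_osc].
  apply poscont_ex_derive. intros x Hx. unfold Rpower. now auto_derive.
- apply poscont_ex_derive. intros x Hx. unfold Rpower. now auto_derive.
- intros n r Hr. unfold f. rewrite !Rabs_mult, (Rabs_pos_eq (Rpower _ _)).
  2:{ left; apply Rpower_pos. }
  rewrite Rmult_assoc. apply Rmult_le_compat_l. left; apply Rpower_pos.
  rewrite <- (Rmult_1_l (exp _)). apply Rmult_le_compat; try apply Rabs_pos.
  + apply Rle_trans with (1 := ray_kernel_le _ _ _). rewrite <- exp_0. apply exp_le_compat.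
    destruct (Hph n) as [_ [H _]]. assert (0 < r * z) by now apply Rmult_lt_0_compat. nra.
  + apply stable_osc_le.
- intros m M eps HmM He.
  destruct (poscont_bounded (fun r => Rpower r (nu - 1) * stable_osc nu X r) m M)
    as [K [HK0 HK]]; try lra.
  { apply poscont_mult. apply poscont_Rpower. apply poscont_stable_osc. }
  set (Q := 2 * (M * z) * K).
  assert (HQ : 0 < Q) by (unfold Q; repeat apply Rmult_lt_0_compat; lra).
  destruct (nfloor_ex (Q / eps)) as [N [_ HN]].
  { left. now apply Rdiv_lt_0_compat. }
  exists N. intros n HnN r Hr. unfold f.
  replace (Rpower r (nu - 1) * ray_kernel z (ph n) r * stable_osc nu X r -
    Rpower r (nu - 1) * cos (r * z) * stable_osc nu X r)
    with ((ray_kernel z (ph n) r - cos (r * z)) * (Rpower r (nu - 1) * stable_osc nu X r)) by ring.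
  rewrite Rabs_mult. destruct (Hph n) as [Hp1 Hp2].
  assert (D := ray_kernel_diff_le z (ph n) r ltac:(lra) ltac:(lra) Hz).
  assert (B := HK r Hr). apply le_INR in HnN. assert (P0 := pos_INR n).
  apply Rle_lt_trans with (2 * (M * z) * / (INR n + 1) * K).
  + apply Rmult_le_compat; try apply Rabs_pos; auto.
    apply Rle_trans with (1 := D). apply Rmult_le_compat; nra.
  + replace (2 * (M * z) * / (INR n + 1) * K) with (Q / (INR n + 1)) by (unfold Q; field; lra).
    apply Rlt_div_l. lra. assert (H7 : Q / eps < INR n + 1) by lra.
    apply Rlt_div_l in H7; auto. lra. }
destruct H0 as [l0 [Hl0 Hlim]].
destruct (Tannery (fun n k => term (ph n) k) (term (PI / 2))
    (fun k => Gamma (nu * (INR k + 1)) * (X * Rpower z (- nu)) ^ k / INR (fact k) * Rpower z (- nu)))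
    as [_ Hlim'].
- intros n k. unfold term, a. assert (Ha := wright_arg_pos nu k (proj1 Hnu)).
    assert (G := Gamma_pos _ Ha). assert (F := fact_inv_pos k).
    assert (E : Rpower z (- (nu * (INR k + 1))) = Rpower z (- nu) * Rpower z (- nu) ^ k).
    { rewrite <- Rpower_succ_nat. f_equal. ring. }
    rewrite E, Rpow_mult_distr. assert (P := Rpower_pos z (- nu)).
    assert (P1 : 0 < Rpower z (- nu) ^ k) by now apply pow_lt.
    assert (P2 : 0 < X ^ k) by now apply pow_lt.
    set (B := Gamma (nu * (INR k + 1)) * (X ^ k * Rpower z (- nu) ^ k) / INR (fact k) * Rpower z (- nu)).
    assert (HB : 0 < B) by (unfold B, Rdiv; repeat apply Rmult_lt_0_compat; lra).
    match goal with |- Rabs ?T <= _ => replace T with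
      (B * (osc_coef nu k * cos (nu * (INR k + 1) * ph n))) by (unfold B, Rdiv; ring) end.
    rewrite Rabs_mult, Rabs_pos_eq, Rabs_mult by lra.
    assert (C1 := osc_coef_le nu k). assert (C2 := Rabs_cos_le (nu * (INR k + 1) * ph n)).
    assert (C3 := Rabs_pos (osc_coef nu k)).
    assert (C4 := Rabs_pos (cos (nu * (INR k + 1) * ph n))).
    rewrite <- (Rmult_1_r B) at 2. apply Rmult_le_compat_l; nra.
- apply (ex_series_scal_r (Rpower z (- nu))
      (fun k => Gamma (nu * (INR k + 1)) * (X * Rpower z (- nu)) ^ k / INR (fact k))).
    apply ex_series_Gamma; auto. apply Rmult_lt_0_compat; auto. apply Rpower_pos.
- intros k. apply (is_lim_seq_continuous (fun p => term p k) ph (PI / 2)).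
    2:{ apply is_lim_seq_half_pi. }
    apply ex_derive_continuity_pt. unfold term. now auto_derive.
- apply is_lim_seq_unique in Hlim. apply is_lim_seq_unique in Hlim'.
    change (Lim_seq (fun n => Series (term (ph n))) = Series (term (PI / 2))) in Hlim'.
    rewrite Hlim in Hlim'. injection Hlim' as ->.
    revert Hl0. apply pint_eq. unfold wright, PSeries.
    rewrite <- Rmult_assoc, <- Series_scal_l. apply Series_ext. intros k.
    unfold term, osc_coef, wright_coef, a. rewrite rgamma_reflection.
    2:{ apply wright_arg_pos. lra. }
    assert (E : Rpower z (- (nu * (INR k + 1))) = Rpower z (- nu) * Rpower z (- nu) ^ k).
    { rewrite <- Rpower_succ_nat. f_equal. ring. }
    rewrite E, Rpow_mult_distr.
    replace (PI * (nu * (INR k + 1))) with (2 * (nu * (INR k + 1) * (PI / 2))) by field.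
    rewrite sin_2a. replace (PI / 2 * (nu * (INR k + 1))) with (nu * (INR k + 1) * (PI / 2)) by ring.
    field. split; [lra | apply INR_fact_neq_0].
Qed.

Lemma pint_gauss_moment a t : 0 < a -> 0 < t ->
  pint (fun r => Rpower r (a - 1) * exp (- (t * r ^ 2))) (/ 2 * Rpower t (- (a / 2)) * Gamma (a / 2)).
Proof.
intros Ha Ht.
assert (H := pint_subst_Rpower _ _ t 2 Ht ltac:(lra) (poscont_Gamma_integrand (a / 2))
  (pint_Gamma (a / 2) ltac:(lra))).
generalize (pint_scal _ (/ 2 * Rpower t (- (a / 2))) _ H). apply pint_ext.
intros r Hr. unfold Gamma_integrand.
assert (E : Rpower r 2 = r ^ 2) by (rewrite <- (Rpower_pow 2 r Hr); f_equal; simpl; ring).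
rewrite <- Rpower_mult_distr, Rpower_mult, E; auto using Rpower_pos.
replace (2 * (a / 2 - 1)) with (a - 1 + - (1)) by field.
replace (a / 2 - 1) with (a / 2 + - (1)) by ring. replace (2 - 1) with 1 by ring.
rewrite !Rpower_plus, !Rpower_Ropp, !Rpower_1 by auto.
assert (P := Rpower_pos t (a / 2)). field. lra.
Qed.

Lemma pint_gauss_stable_osc nu X t : 0 < nu <= 1 -> 0 < X -> 0 < t ->
  pint (fun r => Rpower r (nu - 1) * exp (- (t * r ^ 2)) * stable_osc nu X r)
    (PI / 2 * (Rpower t (- (nu / 2)) * wright (nu / 2) (X * Rpower t (- (nu / 2))))).
Proof.
intros Hnu HX Ht. assert (HP := PI_RGT_0).
set (C := X + (X + 1) ^ 2 / (4 * t)).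
assert (HG := pint_scal _ (exp C) _ (pint_Gamma nu (proj1 Hnu))).
set (I k := X ^ k * (/ 2 * Rpower t (- (nu * (INR k + 1) / 2)) * Gamma (nu * (INR k + 1) / 2))).
assert (H0 : exists l,
  pint (fun r => Rpower r (nu - 1) * exp (- (t * r ^ 2)) * stable_osc nu X r) l /\
  is_series (fun k => osc_coef nu k * (I k / INR (fact k))) l).
{ refine (pint_exp_series (fun r => Rpower r (nu - 1) * exp (- (t * r ^ 2)))
  (fun r => X * Rpower r nu) (stable_osc nu X) _ (osc_coef nu) I _ _ _ _ _ HG _ _ _ _).
- apply poscont_ex_derive. intros x Hx. unfold Rpower. now auto_derive.
- apply poscont_scal, poscont_Rpower.
- apply poscont_stable_osc.
- apply poscont_scal, poscont_Gamma_integrand.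
- apply osc_coef_le.
- intros r Hr. assert (P := Rpower_pos r nu). assert (P1 := Rpower_pos r (nu - 1)).
  unfold Gamma_integrand.
  rewrite !Rabs_mult, (Rabs_pos_eq (exp _)), (Rabs_pos_eq (Rpower _ _)), (Rabs_pos_eq X),
    (Rabs_pos_eq (Rpower _ _)) by (try (left; apply exp_pos); lra).
  rewrite Rmult_assoc, <- exp_plus.
  replace (exp C * (Rpower r (nu - 1) * exp (- r)))
    with (Rpower r (nu - 1) * (exp C * exp (- r))) by ring.
  rewrite <- exp_plus. apply Rmult_le_compat_l. lra. apply exp_le_compat.
  assert (H := exp_chord nu (ln r) ltac:(lra)). rewrite exp_ln in H by auto.
  fold (Rpower r nu) in H.
  assert (Q : 0 <= t * (r - (X + 1) / (2 * t)) ^ 2).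
  { apply Rmult_le_pos. lra. apply pow2_ge_0. }
  replace (t * (r - (X + 1) / (2 * t)) ^ 2)
    with (t * r ^ 2 - (X + 1) * r + (X + 1) ^ 2 / (4 * t)) in Q by (field; lra).
  assert (X * Rpower r nu <= X * (1 + r)) by (apply Rmult_le_compat_l; nra).
  unfold C. lra.
- intros r _. now apply is_series_stable_osc.
- intros k. assert (Ha := wright_arg_pos nu k (proj1 Hnu)).
  generalize (pint_scal _ (X ^ k) _ (pint_gauss_moment _ t Ha Ht)). apply pint_ext.
  intros r Hr. rewrite Rpow_mult_distr.
  replace (Rpower r (nu * (INR k + 1) - 1)) with (Rpower r (nu - 1) * Rpower r nu ^ k). ring.
  replace (nu * (INR k + 1) - 1) with (nu * (INR k + 1) + - (1)) by ring.
  rewrite Rpower_plus, Rpower_succ_nat. replace (nu - 1) with (nu + - (1)) by ring.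
  rewrite Rpower_plus. ring. }
destruct H0 as [l [Hl1 Hl2]].
revert Hl1. apply pint_eq. rewrite <- (is_series_unique _ _ Hl2). unfold wright, PSeries.
  rewrite <- Rmult_assoc, <- Series_scal_l. apply Series_ext. intros k.
  unfold I, osc_coef, wright_coef.
  assert (Ha := wright_arg_pos (nu / 2) k ltac:(lra)).
  rewrite rgamma_reflection by auto.
  replace (nu * (INR k + 1) / 2) with (nu / 2 * (INR k + 1)) by field.
  assert (E : Rpower t (- (nu / 2 * (INR k + 1))) = Rpower t (- (nu / 2)) * Rpower t (- (nu / 2)) ^ k).
  { rewrite <- Rpower_succ_nat. f_equal. ring. }
  rewrite E, Rpow_mult_distr.
  replace (PI * (nu / 2 * (INR k + 1))) with (PI / 2 * (nu * (INR k + 1))) by field.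
  field. split; [lra | apply INR_fact_neq_0].
Qed.

Lemma Gamma_nat_half m :
  Gamma (INR m + / 2) = INR (fact (2 * m)) / (4 ^ m * INR (fact m)) * sqrt PI.
Proof.
induction m.
- simpl. rewrite Rplus_0_l, Gamma_half. field.
- rewrite S_INR. replace (INR m + 1 + / 2) with (INR m + / 2 + 1) by ring.
  assert (H := pos_INR m).
  rewrite Gamma_succ, IHm by lra.
  replace (2 * S m)%nat with (S (S (2 * m))) by lia.
  rewrite !fact_simpl, !mult_INR, !S_INR, mult_INR. simpl (4 ^ S m).
  change (INR 2) with 2. 
  assert (F := INR_fact_neq_0 m). assert (F4 : 4 ^ m <> 0) by (apply pow_nonzero; lra).
  field. repeat split; auto; lra.
Qed.

Lemma wright_half y : wright (/ 2) y = exp (- (y ^ 2 / 4)) / sqrt PI.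
Proof.
assert (HP := PI_RGT_0). assert (HS := sqrt_lt_R0 PI HP).
assert (HS2 := sqrt_sqrt PI ltac:(lra)).
assert (E : is_pseries (wright_coef (/ 2)) y (exp (- (y ^ 2 / 4)) / sqrt PI + y * 0)).
2:{ unfold wright. rewrite (is_pseries_unique _ _ _ E). ring. }
apply is_pseries_odd_even.
- apply is_pseries_R.
  replace (exp (- (y ^ 2 / 4)) / sqrt PI) with (/ sqrt PI * exp (- (y ^ 2 / 4))) by (unfold Rdiv; ring).
  generalize (is_series_scal_l (/ sqrt PI) _ _ (is_series_exp (- (y ^ 2 / 4)))).
  apply is_series_ext. intros m.
  change (/ sqrt PI * ((- (y ^ 2 / 4)) ^ m / INR (fact m)) = wright_coef (/ 2) (2 * m) * (y ^ 2) ^ m).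
  unfold wright_coef.
  replace (/ 2 * (INR (2 * m) + 1)) with (INR m + / 2)
    by (rewrite mult_INR; change (INR 2) with 2; field).
  assert (H := pos_INR m). rewrite rgamma_reflection, Gamma_nat_half by lra.
  replace (PI * (INR m + / 2)) with (PI / 2 + INR m * PI) by field.
  rewrite sin_add_nat_PI, sin_PI2, pow_1_even.
  replace (- (y ^ 2 / 4)) with ((-1) * (y ^ 2) * / 4) by field.
  rewrite !Rpow_mult_distr, pow_inv.
  set (s := sqrt PI) in *. clearbody s. rewrite <- HS2.
  assert (F := INR_fact_neq_0 m). assert (F2 := INR_fact_neq_0 (2 * m)).
  assert (F4 : 4 ^ m <> 0) by (apply pow_nonzero; lra).
  field. repeat split; auto; lra.
- apply is_pseries_R.
  apply (is_lim_seq_ext (fun _ => 0) _ 0); [|apply is_lim_seq_const].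
  intros n. rewrite sum_n_Reals. symmetry. apply sum_eq_R0. intros m _.
  unfold wright_coef.
  replace (/ 2 * (INR (2 * m + 1) + 1)) with (INR m + 1)
    by (rewrite plus_INR, mult_INR; change (INR 2) with 2; simpl (INR 1); field).
  assert (H := pos_INR m). rewrite rgamma_reflection by lra.
  replace (PI * (INR m + 1)) with (0 + INR (S m) * PI) by (rewrite S_INR; ring).
  rewrite sin_add_nat_PI, sin_0. unfold Rdiv. ring.
Qed.

Lemma pint_gauss_cos ka r : 0 < ka -> 0 < r ->
  pint (fun z => exp (- (ka * z ^ 2)) * cos (r * z))
    (sqrt PI / 2 * Rpower ka (- / 2) * exp (- (r ^ 2 / (4 * ka)))).
Proof.
intros Hk Hr. assert (HP := PI_RGT_0). assert (HS := sqrt_lt_R0 PI HP).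
assert (H := pint_gauss_stable_osc 1 r ka ltac:(lra) Hr Hk).
replace (1 / 2) with (/ 2) in H by field. rewrite wright_half in H.
apply pint_eq with (PI / 2 * (Rpower ka (- / 2) *
  (exp (- ((r * Rpower ka (- / 2)) ^ 2 / 4)) / sqrt PI))).
- replace ((r * Rpower ka (- / 2)) ^ 2 / 4) with (r ^ 2 / (4 * ka)).
  + rewrite <- (sqrt_sqrt PI) at 1 by lra. field. lra.
  + rewrite Rpow_mult_distr, Rpower_Ropp, Rpower_sqrt, pow_inv, pow2_sqrt by lra. field. lra.
- revert H. apply pint_ext. intros z Hz. unfold stable_osc.
  rewrite Rminus_diag, Rpower_O, Rpower_1, Rmult_1_r, cos_PI2, sin_PI2, Rmult_0_r, Ropp_0, exp_0 by auto.
  rewrite !Rmult_1_l, Rmult_1_r, sin_shift. reflexivity.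
Qed.

(** * The subordination formula *)

Lemma poscont_wright nu X : 0 < nu < 1 -> poscont (fun z => wright nu (X * Rpower z (- nu))).
Proof.
intros Hnu z Hz. apply (continuous_comp (fun z => X * Rpower z (- nu)) (wright nu)).
- apply (poscont_scal X); auto. apply poscont_Rpower.
- apply continuity_pt_filterlim. now apply continuity_pt_wright.
Qed.

Lemma poscont_gauss ka : poscont (fun z => exp (- (ka * z ^ 2))).
Proof. apply poscont_ex_derive. intros x Hx. now auto_derive. Qed.

Lemma pint_gauss_wright_pos nu X t : 0 < nu < 1 -> 0 < X -> 0 < t ->
  pint (fun z => exp (- (/ (4 * t) * z ^ 2)) * (Rpower z (- nu) * wright nu (X * Rpower z (- nu))))
    (sqrt (PI * t) * (Rpower t (- (nu / 2)) * wright (nu / 2) (X * Rpower t (- (nu / 2))))).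
Proof.
intros Hnu HX Ht. assert (HP := PI_RGT_0).
set (ka := / (4 * t)). assert (Hka : 0 < ka) by (apply Rinv_0_lt_compat; lra).
set (g r := Rpower r (nu - 1) * exp (- (X * Rpower r nu * cos (PI * nu / 2)))).
set (k z := exp (- (ka * z ^ 2))).
set (F r z := k z * (Rpower r (nu - 1) * cos (r * z) * stable_osc nu X r)).
set (W z := Rpower z (- nu) * wright nu (X * Rpower z (- nu))).
set (V := Rpower t (- (nu / 2)) * wright (nu / 2) (X * Rpower t (- (nu / 2)))).
set (A z := k z * (PI / 2 * W z)).
set (B r := Rpower r (nu - 1) * stable_osc nu X r *
  (sqrt PI / 2 * Rpower ka (- / 2) * exp (- (r ^ 2 / (4 * ka))))).
assert (HW : poscont W) by (apply poscont_mult; [apply poscont_Rpower | now apply poscont_wright]).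
assert (Hk : poscont k) by apply poscont_gauss.
assert (HK : pint k (/ 2 * Rpower ka (- (1 / 2)) * Gamma (1 / 2))).
{ generalize (pint_gauss_moment 1 ka Rlt_0_1 Hka). apply pint_ext. intros z Hz.
  rewrite Rminus_diag, Rpower_O by auto. unfold k. ring. }
assert (H0 : exists l, pint A l /\ pint B l).
{ refine (pint_fubini F g k _ _ A B _ _ _ _ _ _ _ _ (pint_stable_majorant nu X Hnu HX) HK _ _).
- intros r z Hr Hz. unfold F, k. cbn [pow]. continuity_2d.
  apply continuity_pt_filterlim. now apply poscont_stable_osc.
- apply poscont_ex_derive. intros x Hx. unfold g, Rpower. now auto_derive.
- exact Hk.
- apply poscont_mult; auto. now apply poscont_scal.
- apply poscont_mult. apply poscont_mult. apply poscont_Rpower. apply poscont_stable_osc.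
  apply poscont_ex_derive. intros x Hx. auto_derive. lra.
- intros r _. left. apply Rmult_lt_0_compat; apply exp_pos.
- intros z _. left. apply exp_pos.
- intros r z Hr Hz. unfold F, g. rewrite !Rabs_mult, (Rabs_pos_eq (k z)), (Rabs_pos_eq (Rpower _ _)).
  2:{ left; apply Rpower_pos. } 2:{ left; apply exp_pos. }
  rewrite (Rmult_comm (k z)). apply Rmult_le_compat_r. left; apply exp_pos.
  rewrite Rmult_assoc. apply Rmult_le_compat_l. left; apply Rpower_pos.
  rewrite <- (Rmult_1_l (exp _)). apply Rmult_le_compat; try apply Rabs_pos.
  apply Rabs_cos_le. apply stable_osc_le.
- intros z Hz. apply pint_scal. now apply pint_cos_stable_osc.
- intros r Hr. unfold F, B.
  generalize (pint_scal _ (Rpower r (nu - 1) * stable_osc nu X r) _ (pint_gauss_cos ka r Hka Hr)).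
  apply pint_ext. intros z Hz. unfold k. ring. }
destruct H0 as [l [HA HB]].
assert (HB' : pint B (sqrt PI / 2 * Rpower ka (- / 2) * (PI / 2 * V))).
  { generalize (pint_scal _ (sqrt PI / 2 * Rpower ka (- / 2)) _
      (pint_gauss_stable_osc nu X t ltac:(lra) HX Ht)).
    apply pint_ext. intros r Hr. unfold B.
    replace (r ^ 2 / (4 * ka)) with (t * r ^ 2) by (unfold ka; field; lra). ring. }
  rewrite (pint_unique _ _ _ HB HB') in HA.
  apply (pint_scal _ (2 / PI)) in HA.
  apply pint_eq with (2 / PI * (sqrt PI / 2 * Rpower ka (- / 2) * (PI / 2 * V))).
- replace (Rpower ka (- / 2)) with (2 * sqrt t).
    rewrite sqrt_mult by lra. field. lra.
    unfold ka. rewrite <- (Rpower_1 (4 * t)) at 1 by lra.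
    rewrite <- Rpower_Ropp, Rpower_mult. replace (- (1) * - / 2) with (/ 2) by field.
    rewrite Rpower_sqrt, sqrt_mult by lra. replace 4 with (2 * 2) by ring.
    rewrite sqrt_square by lra. reflexivity.
- revert HA. apply pint_ext. intros z Hz. unfold A, W, k. field. lra.
Qed.

Lemma wright_bounded nu : 0 < nu < 1 -> exists C, 0 < C /\ forall y, 0 <= y -> Rabs (wright nu y) <= C.
Proof.
intros Hnu. assert (HP := PI_RGT_0). assert (HP1 := PI2_1). assert (Hc := cos_stable_pos nu Hnu).
assert (H1 : forall y, 1 <= y -> Rabs (wright nu y) <= / (nu * cos (PI * nu / 2))).
{ intros y Hy. assert (H := pint_cos_stable_osc nu y 1 Hnu ltac:(lra) Rlt_0_1).
  assert (E : Rpower 1 (- nu) = 1) by (unfold Rpower; rewrite ln_1, Rmult_0_r; apply exp_0).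
  rewrite E, Rmult_1_l, Rmult_1_r in H.
  assert (B : Rabs (PI / 2 * wright nu y) <= / (nu * (y * cos (PI * nu / 2)))).
  { refine (pint_abs_le _ _ _ _ _ _ _ H (pint_stable_majorant nu y Hnu ltac:(lra))).
    - apply poscont_mult; [|apply poscont_stable_osc].
      apply poscont_ex_derive. intros x Hx. unfold Rpower. now auto_derive.
    - apply poscont_ex_derive. intros x Hx. unfold Rpower. now auto_derive.
    - intros r Hr. rewrite !Rabs_mult, (Rabs_pos_eq (Rpower _ _)).
      2:{ left; apply Rpower_pos. }
      rewrite Rmult_assoc. apply Rmult_le_compat_l. left; apply Rpower_pos.
      rewrite <- (Rmult_1_l (exp _)). apply Rmult_le_compat; try apply Rabs_pos.
      apply Rabs_cos_le. apply stable_osc_le. }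
  rewrite Rabs_mult, (Rabs_pos_eq (PI / 2)) in B by lra.
  assert (H0 := Rabs_pos (wright nu y)).
  apply Rle_trans with (PI / 2 * Rabs (wright nu y)). nra.
  apply Rle_trans with (1 := B).
  assert (0 < nu * cos (PI * nu / 2)) by (apply Rmult_lt_0_compat; lra).
  apply Rinv_le_contravar; nra. }
destruct (continuity_ab_maj (fun y => Rabs (wright nu y)) 0 1 ltac:(lra)) as [m [Hm _]].
{ intros y _. apply continuity_pt_filterlim. apply (continuous_comp (wright nu) Rabs).
  apply continuity_pt_filterlim. now apply continuity_pt_wright.
  apply (continuous_Rabs (wright nu y)). }
exists (/ (nu * cos (PI * nu / 2)) + Rabs (wright nu m)).
assert (H2 := Rabs_pos (wright nu m)).
assert (H3 : 0 < / (nu * cos (PI * nu / 2))).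
{ apply Rinv_0_lt_compat. apply Rmult_lt_0_compat; lra. }
split. lra. intros y Hy. destruct (Rle_dec 1 y) as [H|H].
- specialize (H1 y H). lra.
- specialize (Hm y ltac:(lra)). lra.
Qed.

Lemma is_lim_seq_inv_nat : is_lim_seq (fun n => / (INR n + 1)) 0.
Proof.
replace (Finite 0) with (Finite (PI / 2 - PI / 2)) by (f_equal; ring).
apply is_lim_seq_ext with (fun n => PI / 2 - (PI / 2 - / (INR n + 1))).
intros n; ring. apply is_lim_seq_minus'. apply is_lim_seq_const. apply is_lim_seq_half_pi.
Qed.

(* At [X = 0] the cosine integral is no longer absolutely convergent, so the identity is obtained
   as the limit [X -> 0]. *)
Lemma pint_gauss_wright nu X t : 0 < nu < 1 -> 0 <= X -> 0 < t ->
  pint (fun z => exp (- (/ (4 * t) * z ^ 2)) * (Rpower z (- nu) * wright nu (X * Rpower z (- nu))))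
    (sqrt (PI * t) * (Rpower t (- (nu / 2)) * wright (nu / 2) (X * Rpower t (- (nu / 2))))).
Proof.
intros Hnu [HX|<-] Ht. now apply pint_gauss_wright_pos.
set (ka := / (4 * t)). assert (Hka : 0 < ka) by (apply Rinv_0_lt_compat; lra).
set (Xn n := / (INR n + 1)).
assert (HXn : forall n, 0 < Xn n).
{ intros n. apply Rinv_0_lt_compat. assert (H := pos_INR n). lra. }
assert (LX : is_lim_seq Xn 0) by apply is_lim_seq_inv_nat.
destruct (wright_bounded nu Hnu) as [C [HC0 HC]].
set (w z := exp (- (ka * z ^ 2)) * Rpower z (- nu)).
assert (Hw : poscont w) by (apply poscont_mult; [apply poscont_gauss | apply poscont_Rpower]).
assert (Hw0 : forall z, 0 < w z) by (intros; apply Rmult_lt_0_compat; apply exp_pos).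
assert (HG : pint (fun z => C * w z) (C * (/ 2 * Rpower ka (- ((1 - nu) / 2)) * Gamma ((1 - nu) / 2)))).
{ apply pint_scal. generalize (pint_gauss_moment (1 - nu) ka ltac:(lra) Hka). apply pint_ext.
  intros z Hz. unfold w. replace (1 - nu - 1) with (- nu) by ring. ring. }
set (l n := sqrt (PI * t) * (Rpower t (- (nu / 2)) * wright (nu / 2) (Xn n * Rpower t (- (nu / 2))))).
assert (H0 : exists l0, pint (fun z => w z * wright nu (0 * Rpower z (- nu))) l0 /\ is_lim_seq l l0).
{ refine (pint_lim (fun n z => w z * wright nu (Xn n * Rpower z (- nu))) _ _ _ _ _ _ _ HG _ _ _).
  - intros n. apply poscont_mult; auto. now apply poscont_wright.
  - apply poscont_mult; auto. now apply poscont_wright.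
  - now apply poscont_scal.
  - intros n z Hz. rewrite Rabs_mult, (Rabs_pos_eq (w z)), Rmult_comm by (left; apply Hw0).
    apply Rmult_le_compat_r. left; apply Hw0. apply HC. left.
    apply Rmult_lt_0_compat; auto. apply Rpower_pos.
  - intros m M eps HmM He.
    destruct (poscont_bounded w m M Hw ltac:(lra)) as [K [HK0 HK]].
    destruct (poscont_bounded (fun z => Rpower z (- nu)) m M (poscont_Rpower _) ltac:(lra))
      as [Q [HQ0 HQ]].
    assert (He' : 0 < eps / K) by (apply Rdiv_lt_0_compat; lra).
    destruct (continuity_pt_wright nu 0 Hnu (eps / K) He') as [d [Hd Hcont]].
    apply is_lim_seq_spec in LX.
    assert (Hd' : 0 < d / Q) by (apply Rdiv_lt_0_compat; lra).
    destruct (LX (mkposreal _ Hd')) as [N HN]. exists N. intros n Hn z Hz.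
    specialize (HN n Hn). simpl in HN.
    rewrite Rminus_0_r, Rabs_pos_eq in HN by (left; apply HXn).
    rewrite Rmult_0_l, <- Rmult_minus_distr_l, Rabs_mult.
    assert (P := Rpower_pos z (- nu)). specialize (HXn n). specialize (HQ z Hz).
    rewrite Rabs_pos_eq in HQ by lra.
    assert (B : Rabs (wright nu (Xn n * Rpower z (- nu)) - wright nu 0) < eps / K).
    { apply Hcont. split.
      - split. exact I. apply Rlt_not_eq. now apply Rmult_lt_0_compat.
      - simpl. unfold R_dist. rewrite Rminus_0_r, Rabs_pos_eq by nra.
        apply Rle_lt_trans with (Xn n * Q). apply Rmult_le_compat_l; lra.
        apply Rlt_le_trans with (d / Q * Q). now apply Rmult_lt_compat_r. right. field. lra. }
    apply Rle_lt_trans with (K * Rabs (wright nu (Xn n * Rpower z (- nu)) - wright nu 0)).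
    apply Rmult_le_compat_r. apply Rabs_pos. now apply HK.
    apply Rlt_le_trans with (K * (eps / K)). now apply Rmult_lt_compat_l. right. field. lra.
  - intros n. generalize (pint_gauss_wright_pos nu (Xn n) t Hnu (HXn n) Ht). apply pint_ext.
    intros z Hz. unfold w, ka. ring. }
destruct H0 as [l0 [Hl0 Hlim]].
assert (Hlim' : is_lim_seq l
  (sqrt (PI * t) * (Rpower t (- (nu / 2)) * wright (nu / 2) (0 * Rpower t (- (nu / 2)))))).
{ apply (is_lim_seq_continuous (fun x => sqrt (PI * t) *
    (Rpower t (- (nu / 2)) * wright (nu / 2) (x * Rpower t (- (nu / 2))))) Xn 0); auto.
  apply continuity_pt_mult. apply continuity_pt_const. now intros x y.
  apply continuity_pt_mult. apply continuity_pt_const. now intros x y.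
  apply (continuity_pt_comp (fun x => x * Rpower t (- (nu / 2))) (wright (nu / 2))).
  apply ex_derive_continuity_pt. now auto_derive.
  apply continuity_pt_wright. lra. }
apply is_lim_seq_unique in Hlim. apply is_lim_seq_unique in Hlim'.
rewrite Hlim in Hlim'. injection Hlim' as <-.
revert Hl0. apply pint_ext. intros z Hz. unfold w. ring.
Qed.

(* For 0 < nu < 1 the identity is stated pointwise with u_{2nu} given by the series.
   For nu = 1, u_2 is the distribution (delta(x - lambda z) + delta(x + lambda z))/2,
   and the right-hand side is the action of this distribution on e^{-z^2/(4t)}/sqrt(pi t)
   over z > 0, namely e^{-x^2/(4 lambda^2 t)} / (2 lambda sqrt(pi t)) (see NOTES.md). *)
Theorem theorem2p1 (lambda nu : R) (hl : 0 < lambda) (hnu0 : 0 < nu) (hnu1 : nu <= 1) :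
  forall x t : R, 0 < t ->
  (nu < 1 ->
     is_RInt_gen (fun z => / sqrt (PI * t) * (exp (- z ^ 2 / (4 * t)) * u (2 * nu) lambda x z))
       (at_right 0) (Rbar_locally p_infty) (u nu lambda x t)) /\
  (nu = 1 ->
     u nu lambda x t = / sqrt (PI * t) * (exp (- x ^ 2 / (4 * lambda ^ 2 * t)) / (2 * lambda))).
Proof.
intros x t Ht. assert (HP := PI_RGT_0).
assert (HX : 0 <= Rabs x / lambda).
{ apply Rmult_le_pos. apply Rabs_pos. left. now apply Rinv_0_lt_compat. }
assert (Hsq : 0 < sqrt (PI * t)) by (apply sqrt_lt_R0; now apply Rmult_lt_0_compat).
split.
- intros Hnu. rewrite u_wright by auto.
  change (pint (fun z => / sqrt (PI * t) * (exp (- z ^ 2 / (4 * t)) * u (2 * nu) lambda x z))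
    (/ (2 * lambda * Rpower t (nu / 2)) * wright (nu / 2) (Rabs x / lambda * Rpower t (- (nu / 2))))).
  assert (H := pint_scal _ (/ sqrt (PI * t) / (2 * lambda)) _
    (pint_gauss_wright nu (Rabs x / lambda) t (conj hnu0 Hnu) HX Ht)).
  match type of H with pint _ ?l => apply pint_eq with l end.
  + rewrite (Rpower_Ropp t (nu / 2)) at 1. assert (P := Rpower_pos t (nu / 2)). field. lra.
  + revert H. apply pint_ext. intros z Hz. rewrite u_wright by auto.
    replace (2 * nu / 2) with nu by field.
    replace (- z ^ 2 / (4 * t)) with (- (/ (4 * t) * z ^ 2)) by (field; lra).
    rewrite (Rpower_Ropp z nu) at 1. assert (P := Rpower_pos z nu). field. lra.
- intros ->. rewrite u_wright by auto. replace (1 / 2) with (/ 2) by field.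
  rewrite wright_half, Rpower_Ropp, Rpower_sqrt, sqrt_mult by lra.
  assert (H1 := sqrt_lt_R0 PI HP). assert (H2 := sqrt_lt_R0 t Ht).
  replace ((Rabs x / lambda * / sqrt t) ^ 2 / 4) with (- (- x ^ 2 / (4 * lambda ^ 2 * t))).
  + rewrite Ropp_involutive. field. lra.
  + rewrite <- (pow2_abs x), <- (pow2_sqrt t) at 1 by lra. field. lra.
Qed.
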